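(* Let $R$ be a generically Gorenstein local Cohen--Macaulay ring of dimension $1$ with total ring of fractions $Q(R)$. Let $S$ be a ring with $R\subseteq S\subseteq Q(R)$ such that $S$ is finitely generated as an $R$-module. Then the following are equivalent: (1) $S\in\operatorname{Ref}(R)$, and the conductor $\mathfrak c_R(S)=(R:_{Q(R)}S)$ is a stable ideal of $R$. (2) $S\cong\operatorname{Hom}_R(S,R)$ as $R$-modules. (3) $\operatorname{Ref}(S)=\operatorname{CM}(S)\cap\operatorname{Ref}(R)$.
   Context: All rings are commutative and Noetherian, and all modules are finitely generated. A ring is generically Gorenstein if its localizations at all associated primes are Gorenstein. For a ring $A$: $\operatorname{CM}(A)$ is the category of maximal Cohen--Macaulay $A$-modules (modules $M$ with $\operatorname{depth} M_{\mathfrak p}\ge\dim A_{\mathfrak p}$ for all primes $\mathfrak p$, with $\operatorname{depth} 0=\infty$), and $\operatorname{Ref}(A)$ is the category of reflexive $A$-modules (the natural map $M\to\operatorname{Hom}_A(\operatorname{Hom}_A(M,A),A)$ is an isomorphism). The conductor is $\mathfrak c_R(S)=(R:_{Q(R)}S)=\{a\in Q(R): aS\subseteq R\}$, an ideal of both $R$ and $S$. An ideal $I$ of a ring $A$ is regular if it contains a non-zero-divisor of $A$; a regular ideal $I$ is stable if $I\cong\operatorname{Hom}_A(I,I)$ as $A$-modules, equivalently $I\cong (I:_{Q(A)}I)$, where $(I:_{Q(A)}I)=\{a\in Q(A):aI\subseteq I\}$. $S$-modules are regarded as $R$-modules by restriction of scalars; thus $\operatorname{CM}(S)\cap\operatorname{Ref}(R)$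 consists of the maximal Cohen--Macaulay $S$-modules that are reflexive as $R$-modules. *)

(* Defs.v *)
From HB Require Import structures.
From mathcomp Require Import all_boot all_algebra ring_quotient generic_quotient.
From mathcomp Require Import ring boolp.

Set Implicit Arguments.
Unset Strict Implicit.
Unset Printing Implicit Defensive.

Import GRing.Theory.
Local Open Scope ring_scope.
Local Open Scope quotient_scope.

(* Subsets are Boolean predicates, which classically is no restriction.       *)
(* An ideal of A is a [submodClosed A^o]; proper (resp. prime) ideals are the *)
(* [idealr A] (resp. [prime_idealr A]) of ring_quotient.                      *)

Section Submodule.
Variables (A : comNzRingType) (M : lmodType A) (N : submodClosed M).

Record submod := Submod {submod_val :> M; submod_valP : submod_val \in N}.

HB.instance Definition _ := [isSub for submod_val].
HB.instance Definition _ := [Choice of submod by <:].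
HB.instance Definition _ := [SubChoice_isSubLmodule of submod by <:].

End Submodule.

Section Subring.
Variables (Q : comNzRingType) (S : subringClosed Q).

Record subring := Subring {subring_val :> Q; subring_valP : subring_val \in S}.

HB.instance Definition _ := [isSub for subring_val].
HB.instance Definition _ := [Choice of subring by <:].
HB.instance Definition _ := [SubChoice_isSubComNzRing of subring by <:].

Variables (R : comNzRingType) (f : {rmorphism R -> Q}).
Hypothesis fS : forall a, f a \in S.

Definition corestr (a : R) : subring := Subring (fS a).

Lemma corestr_is_zmod_morphism : zmod_morphism corestr.
Proof. by move=> a b; apply/val_inj; rewrite /= raddfB. Qed.

Lemma corestr_is_monoid_morphism : monoid_morphism corestr.
Proof.
by split=> [|a b]; apply/val_inj; rewrite /= ?rmorph1 ?rmorphM.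
Qed.

HB.instance Definition _ :=
  GRing.isZmodMorphism.Build R subring corestr corestr_is_zmod_morphism.
HB.instance Definition _ :=
  GRing.isMonoidMorphism.Build R subring corestr corestr_is_monoid_morphism.

End Subring.

Section Hom.
Variables (A : comNzRingType) (M N : lmodType A).

Definition hom_mod := {linear M -> N}.

HB.instance Definition _ := gen_eqMixin hom_mod.
HB.instance Definition _ := gen_choiceMixin hom_mod.

Lemma hom_ext (f g : hom_mod) : (forall x, f x = g x) -> f = g.
Proof.
case: f g => [f cf] [g cg] /= fg.
have {}fg : f = g by apply/funext.
case: g / fg cg => cg; congr GRing.Linear.Pack.
case: cf cg => [[a] [b]] [[c] [d]].
by rewrite (Prop_irrelevance a c) (Prop_irrelevance b d).
Qed.

Definition hom_zero : hom_mod := (\0 : {linear M -> N}).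
Definition hom_opp (f : hom_mod) : hom_mod := (\- (f : {linear M -> N}) : {linear M -> N}).
Definition hom_add (f g : hom_mod) : hom_mod :=
  ((f : {linear M -> N}) \+ (g : {linear M -> N}) : {linear M -> N}).
Definition hom_scale (a : A) (f : hom_mod) : hom_mod :=
  (a \*: (f : {linear M -> N}) : {linear M -> N}).


Lemma hom_addA : associative hom_add.
Proof. by move=> f g h; apply: hom_ext => x /=; rewrite addrA. Qed.

Lemma hom_addC : commutative hom_add.
Proof. by move=> f g; apply: hom_ext => x /=; rewrite addrC. Qed.

Lemma hom_add0 : left_id hom_zero hom_add.
Proof. by move=> f; apply: hom_ext => x /=; rewrite add0r. Qed.

Lemma hom_addN : left_inverse hom_zero hom_opp hom_add.
Proof. by move=> f; apply: hom_ext => x /=; rewrite addNr. Qed.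

HB.instance Definition _ :=
  GRing.isZmodule.Build hom_mod hom_addA hom_addC hom_add0 hom_addN.

Lemma hom_scaleA a b f : hom_scale a (hom_scale b f) = hom_scale (a * b) f.
Proof. by apply: hom_ext => x /=; rewrite scalerA. Qed.

Lemma hom_scale1 : left_id 1 hom_scale.
Proof. by move=> f; apply: hom_ext => x /=; rewrite scale1r. Qed.

Lemma hom_scaleDr : right_distributive hom_scale +%R.
Proof. by move=> a f g; apply: hom_ext => x /=; rewrite scalerDr. Qed.

Lemma hom_scaleDl f : {morph hom_scale^~ f : a b / a + b}.
Proof. by move=> a b; apply: hom_ext => x /=; rewrite scalerDl. Qed.

HB.instance Definition _ := GRing.Zmodule_isLmodule.Build A hom_mod
  hom_scaleA hom_scale1 hom_scaleDr hom_scaleDl.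

End Hom.

Definition isomorphic (A : comNzRingType) (M N : lmodType A) : Prop :=
  exists f : {linear M -> N}, bijective f.

Section Biduality.
Variables (A : comNzRingType) (M : lmodType A).

Definition eval_at (x : M) (f : hom_mod M A^o) : A^o := f x.

Lemma eval_at_is_linear x : linear (eval_at x).
Proof. by []. Qed.

HB.instance Definition _ x :=
  GRing.isLinear.Build A (hom_mod M A^o) A^o _ (eval_at x) (eval_at_is_linear x).

Definition biduality (x : M) : hom_mod (hom_mod M A^o) A^o :=
  (eval_at x : {linear hom_mod M A^o -> A^o}).

End Biduality.

(* [phi] is a phantom argument, from which the R-module structure is inferred *)
Definition restr (R S : comNzRingType) (phi : {rmorphism R -> S})
  (M : lmodType S) : Type := M.

Section Restriction.
Variables (R S : comNzRingType) (phi : {rmorphism R -> S}) (M : lmodType S).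
Local Notation restr := (restr phi M).

HB.instance Definition _ := GRing.Zmodule.copy restr M.

Definition restr_scale (a : R) (x : restr) : restr := phi a *: (x : M).

Lemma restr_scaleA a b x :
  restr_scale a (restr_scale b x) = restr_scale (a * b) x.
Proof. by rewrite /restr_scale scalerA rmorphM. Qed.

Lemma restr_scale1 : left_id 1 restr_scale.
Proof. by move=> x; rewrite /restr_scale rmorph1 scale1r. Qed.

Lemma restr_scaleDr : right_distributive restr_scale +%R.
Proof. by move=> a x y; rewrite /restr_scale scalerDr. Qed.

Lemma restr_scaleDl x : {morph restr_scale^~ x : a b / a + b}.
Proof. by move=> a b; rewrite /restr_scale rmorphD scalerDl. Qed.

HB.instance Definition _ := GRing.Zmodule_isLmodule.Build R restr
  restr_scaleA restr_scale1 restr_scaleDr restr_scaleDl.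

End Restriction.

Record multset (A : comNzRingType) := Multset {
  multset_pred :> {pred A};
  multset1 : 1 \in multset_pred;
  multset0 : 0 \notin multset_pred;
  multsetM : {in multset_pred &, forall a b, a * b \in multset_pred} }.

Section Localization.
Variables (A : comNzRingType) (T : multset A) (M : lmodType A).

Record denom := Denom {denom_val :> GRing.PzSemiRing.sort A; denomP : denom_val \in multset_pred T}.

HB.instance Definition _ := [isSub for denom_val].
HB.instance Definition _ := [Choice of denom by <:].

Definition denom1 : denom := Denom (multset1 T).
Definition denomM (s t : denom) : denom :=
  Denom (multsetM (denomP s) (denomP t)).

Definition frac_equiv (x y : M * denom) : bool :=
  `[< exists u : denom, u *: (y.2 *: x.1 - x.2 *: y.1) = 0 >].

Lemma frac_equivP (x y : M * denom) :
  reflect (exists u : denom, (u * y.2) *: x.1 = (u * x.2) *: y.1)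
    (frac_equiv x y).
Proof.
apply: (iffP (asboolP _)) => -[u hu]; exists u.
  by apply/eqP; rewrite -subr_eq0 -!scalerA -scalerBr hu.
by rewrite scalerBr !scalerA hu subrr.
Qed.

Lemma frac_equiv_is_equiv : equiv_class_of frac_equiv.
Proof.
split=> [x|x y|y x z].
- by apply/frac_equivP; exists denom1.
- by apply/frac_equivP/frac_equivP => -[u hu]; exists u.
move=> /frac_equivP[u hu] /frac_equivP[v hv]; apply/frac_equivP.
exists (denomM (denomM u v) y.2) => /=.
have -> : u * v * y.2 * z.2 = (v * z.2) * (u * y.2) by ring.
rewrite -scalerA hu scalerA.
have -> : v * z.2 * (u * x.2) = (u * x.2) * (v * z.2) by ring.
rewrite -scalerA hv scalerA; congr (_ *: _); ring.
Qed.

Canonical frac_equiv_equiv := EquivRelPack frac_equiv_is_equiv.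
Canonical frac_equiv_encModRel := defaultEncModRel frac_equiv.

Definition loc := {eq_quot frac_equiv}.

HB.instance Definition _ := EqQuotient.on loc.
HB.instance Definition _ := Choice.on loc.

Definition locfrac (m : M) (s : denom) : loc := \pi_loc (m, s).

Lemma frac_eqP (m n : M) (s t : denom) :
  (locfrac m s = locfrac n t) <->
  (exists u : denom, (u * t) *: m = (u * s) *: n).
Proof. by split=> [/eqmodP/frac_equivP//|h]; apply/eqmodP/frac_equivP. Qed.

Lemma fracP (x : loc) : exists m s, x = locfrac m s.
Proof. by exists (repr x).1, (repr x).2; rewrite /locfrac -surjective_pairing reprK. Qed.

Definition loc_zero : loc := locfrac 0 denom1.
Definition loc_opp (x : loc) : loc := locfrac (- (repr x).1) (repr x).2.
Definition loc_add (x y : loc) : loc :=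
  locfrac ((repr y).2 *: (repr x).1 + (repr x).2 *: (repr y).1)
    (denomM (repr x).2 (repr y).2).

Lemma repr_frac (m : M) (s : denom) : exists u : denom,
  (u * s) *: (repr (locfrac m s)).1 = (u * (repr (locfrac m s)).2) *: m.
Proof.
by apply/frac_eqP; rewrite /locfrac -surjective_pairing reprK.
Qed.

Lemma loc_oppE (m : M) (s : denom) : loc_opp (locfrac m s) = locfrac (- m) s.
Proof.
apply/frac_eqP; have [u hu] := repr_frac m s.
by exists u; rewrite !scalerN hu.
Qed.

Lemma loc_addE (m n : M) (s t : denom) :
  loc_add (locfrac m s) (locfrac n t) =
  locfrac (t *: m + s *: n) (denomM s t).
Proof.
apply/frac_eqP; have [u hu] := repr_frac m s; have [v hv] := repr_frac n t.
set x := repr (locfrac m s) in hu *; set y := repr (locfrac n t) in hv *.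
exists (denomM u v) => /=; rewrite !scalerDr !scalerA.
have -> : u * v * (s * t) * y.2 = (v * t * y.2) * (u * s) by ring.
have -> : u * v * (s * t) * x.2 = (u * s * x.2) * (v * t) by ring.
rewrite -2!(scalerA _ (_ * _)) hu hv !scalerA.
by congr (_ *: _ + _ *: _); ring.
Qed.

Lemma loc_addA : associative loc_add.
Proof.
move=> x y z; have [m [s ->]] := fracP x; have [n [t ->]] := fracP y.
have [p [u ->]] := fracP z; rewrite !loc_addE; apply/frac_eqP; exists denom1.
rewrite /= !mul1r !scalerDr !scalerA !addrA.
by congr (_ *: _ + _ *: _ + _ *: _); ring.
Qed.

Lemma loc_addC : commutative loc_add.
Proof.
move=> x y; have [m [s ->]] := fracP x; have [n [t ->]] := fracP y.
rewrite !loc_addE; apply/frac_eqP; exists denom1.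
by rewrite /= addrC [s * t]mulrC.
Qed.

Lemma loc_add0 : left_id loc_zero loc_add.
Proof.
move=> x; have [m [s ->]] := fracP x.
rewrite loc_addE; apply/frac_eqP; exists denom1.
by rewrite /= scaler0 add0r scale1r !mul1r.
Qed.

Lemma loc_addN : left_inverse loc_zero loc_opp loc_add.
Proof.
move=> x; have [m [s ->]] := fracP x.
rewrite loc_oppE loc_addE; apply/frac_eqP; exists denom1.
by rewrite /= scalerN addNr !scaler0.
Qed.

HB.instance Definition _ :=
  GRing.isZmodule.Build loc loc_addA loc_addC loc_add0 loc_addN.

Lemma frac_add (m n : M) (s t : denom) :
  locfrac m s + locfrac n t = locfrac (t *: m + s *: n) (denomM s t).
Proof. exact: loc_addE. Qed.

End Localization.

Arguments locfrac {A T M}.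

Definition loc_ring (A : comNzRingType) (T : multset A) : Type := loc T A^o.

Section LocalizationRing.
Variables (A : comNzRingType) (T : multset A).

HB.instance Definition _ := GRing.Zmodule.copy (loc_ring T) (loc T A^o).

Definition ringfrac (a : A) (s : denom T) : loc_ring T := locfrac (a : A^o) s.

Lemma ringfracP (x : loc_ring T) : exists a s, x = ringfrac a s.
Proof. exact: (@fracP A T A^o x). Qed.

Lemma ringfrac_eqP (a b : A) (s t : denom T) :
  (ringfrac a s = ringfrac b t) <->
  (exists u : denom T, u * t * a = u * s * b).
Proof. exact: (@frac_eqP A T A^o a b s t). Qed.

Lemma ringfrac_add (a b : A) (s t : denom T) :
  ringfrac a s + ringfrac b t = ringfrac (t * a + s * b) (denomM s t).
Proof. exact: (@frac_add A T A^o a b s t). Qed.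

Section Action.
Variable M : lmodType A.

Definition loc_scale (x : loc_ring T) (y : loc T M) : loc T M :=
  locfrac (((repr (x : loc T A^o)).1 : A) *: (repr y).1)
    (denomM (repr (x : loc T A^o)).2 (repr y).2).

Lemma loc_scaleE (a : A) (s : denom T) (m : M) (t : denom T) :
  loc_scale (ringfrac a s) (locfrac m t) = locfrac (a *: m) (denomM s t).
Proof.
apply/frac_eqP; have [u hu] := @repr_frac A T A^o a s.
have [v hv] := repr_frac m t.
set x := repr _ in hu; set y := repr (locfrac m t) in hv *.
rewrite -/x; exists (denomM u v) => /=; rewrite !scalerA.
have -> : u * v * (s * t) * x.1 = (u * s * x.1) * (v * t) by ring.
rewrite -scalerA hv scalerA.
have {}hu : u * s * x.1 = u * x.2 * a by exact: hu.
by rewrite hu; congr (_ *: _); ring.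
Qed.

End Action.

Definition loc_one : loc_ring T := ringfrac 1 (denom1 T).
Definition loc_mul (x y : loc_ring T) : loc_ring T := @loc_scale A^o x y.

Lemma loc_mulE (a b : A) (s t : denom T) :
  loc_mul (ringfrac a s) (ringfrac b t) = ringfrac (a * b) (denomM s t).
Proof. exact: (@loc_scaleE A^o a s b t). Qed.

Lemma loc_mulA : associative loc_mul.
Proof.
move=> x y z; have [a [s ->]] := ringfracP x; have [b [t ->]] := ringfracP y.
have [c [u ->]] := ringfracP z; rewrite !loc_mulE.
apply/ringfrac_eqP; exists (denom1 T) => /=; ring.
Qed.

Lemma loc_mulC : commutative loc_mul.
Proof.
move=> x y; have [a [s ->]] := ringfracP x; have [b [t ->]] := ringfracP y.
rewrite !loc_mulE; apply/ringfrac_eqP; exists (denom1 T) => /=; ring.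
Qed.

Lemma loc_mul1 : left_id loc_one loc_mul.
Proof.
move=> x; have [a [s ->]] := ringfracP x.
rewrite loc_mulE; apply/ringfrac_eqP; exists (denom1 T) => /=; ring.
Qed.

Lemma loc_mulDl : left_distributive loc_mul +%R.
Proof.
move=> x y z; have [a [s ->]] := ringfracP x; have [b [t ->]] := ringfracP y.
have [c [u ->]] := ringfracP z; rewrite !(ringfrac_add, loc_mulE).
apply/ringfrac_eqP; exists (denom1 T) => /=; ring.
Qed.

Lemma loc_one_neq0 : loc_one != 0.
Proof.
apply/eqP => /(@ringfrac_eqP 1 0 (denom1 T) (denom1 T))[u].
rewrite /= !mulr1 mulr0 => u0; have := denomP u.
by rewrite u0 (negPf (multset0 T)).
Qed.

HB.instance Definition _ := GRing.Zmodule_isComNzRing.Build (loc_ring T)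
  loc_mulA loc_mulC loc_mul1 loc_mulDl loc_one_neq0.

Lemma ringfrac_mul (a b : A) (s t : denom T) :
  ringfrac a s * ringfrac b t = ringfrac (a * b) (denomM s t).
Proof. exact: loc_mulE. Qed.

Definition to_loc (a : A) : loc_ring T := ringfrac a (denom1 T).

Lemma to_loc_is_zmod_morphism : zmod_morphism to_loc.
Proof.
move=> a b; apply/esym/(canLR (addrK _)).
rewrite /to_loc ringfrac_add; apply/ringfrac_eqP; exists (denom1 T) => /=; ring.
Qed.

Lemma to_loc_is_monoid_morphism : monoid_morphism to_loc.
Proof.
split=> // a b; rewrite /to_loc ringfrac_mul.
by apply/ringfrac_eqP; exists (denom1 T) => /=; ring.
Qed.

HB.instance Definition _ :=
  GRing.isZmodMorphism.Build A (loc_ring T) to_loc to_loc_is_zmod_morphism.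
HB.instance Definition _ :=
  GRing.isMonoidMorphism.Build A (loc_ring T) to_loc to_loc_is_monoid_morphism.

Section Module.
Variable M : lmodType A.

Lemma loc_scaleA x y (m : loc T M) :
  loc_scale x (loc_scale y m) = loc_scale (x * y) m.
Proof.
have [a [s ->]] := ringfracP x; have [b [t ->]] := ringfracP y.
have [n [u ->]] := fracP m; rewrite ringfrac_mul !loc_scaleE.
by apply/frac_eqP; exists (denom1 T) => /=; rewrite !scalerA; congr (_ *: _); ring.
Qed.

Lemma loc_scale1 : left_id 1 (@loc_scale M).
Proof.
move=> m; have [n [u ->]] := fracP m.
rewrite (_ : 1 = ringfrac 1 (denom1 T)) // loc_scaleE.
by apply/frac_eqP; exists (denom1 T) => /=; rewrite !scalerA; congr (_ *: _); ring.
Qed.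

Lemma loc_scaleDr : right_distributive (@loc_scale M) +%R.
Proof.
move=> x m n; have [a [s ->]] := ringfracP x.
have [p [t ->]] := fracP m; have [q [u ->]] := fracP n.
rewrite !(frac_add, loc_scaleE); apply/frac_eqP; exists (denom1 T) => /=.
by rewrite !scalerDr !scalerA; congr (_ *: _ + _ *: _); ring.
Qed.

Lemma loc_scaleDl (m : loc T M) : {morph (@loc_scale M)^~ m : x y / x + y}.
Proof.
move=> x y; have [a [s ->]] := ringfracP x; have [b [t ->]] := ringfracP y.
have [n [u ->]] := fracP m; rewrite !(ringfrac_add, frac_add, loc_scaleE).
apply/frac_eqP; exists (denom1 T) => /=.
rewrite !scalerDr !scalerA -scalerDl; congr (_ *: _); ring.
Qed.

HB.instance Definition _ := GRing.Zmodule_isLmodule.Build (loc_ring T) (loc T M)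
  loc_scaleA loc_scale1 loc_scaleDr loc_scaleDl.

End Module.
End LocalizationRing.

Section Multsets.
Variable A : comNzRingType.

Section PrimeComplement.
Variable p : prime_idealr A.

Lemma prime_compl1 : 1 \in [pred a : A | a \notin p].
Proof. by rewrite inE idealr1. Qed.

Lemma prime_compl0 : 0 \notin [pred a : A | a \notin p].
Proof. by rewrite inE negbK idealr0. Qed.

Lemma prime_complM : {in [pred a : A | a \notin p] &,
  forall a b, a * b \in [pred a : A | a \notin p]}.
Proof.
by move=> a b; rewrite !inE prime_idealrM => /negPf-> /negPf->.
Qed.

Definition prime_compl : multset A :=
  Multset prime_compl1 prime_compl0 prime_complM.

End PrimeComplement.

Definition nonzerodivisor : pred A := [pred a : A | `[< GRing.lreg a >]].

Lemma nonzerodivisor1 : 1 \in nonzerodivisor.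
Proof. by rewrite inE; apply/asboolP; exact: lreg1. Qed.

Lemma nonzerodivisor0 : 0 \notin nonzerodivisor.
Proof.
rewrite inE; apply/asboolP => /(_ 0 1); rewrite !mul0r => /(_ erefl)/eqP.
by rewrite eq_sym oner_eq0.
Qed.

Lemma nonzerodivisorM :
  {in nonzerodivisor &, forall a b, a * b \in nonzerodivisor}.
Proof.
move=> a b; rewrite !inE => /asboolP ra /asboolP rb.
by apply/asboolP; exact: lregM.
Qed.

Definition nonzerodivisors : multset A :=
  Multset nonzerodivisor1 nonzerodivisor0 nonzerodivisorM.

End Multsets.

Notation localization p := (loc_ring (prime_compl p)).
Notation localization_mod p M := (loc (prime_compl p) M).
Notation total_fractions A := (loc_ring (nonzerodivisors A)).

Section Finiteness.
Variable A : comNzRingType.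

Definition fin_gen (M : lmodType A) : Prop :=
  exists (n : nat) (g : 'I_n -> M),
    forall x, exists c : 'I_n -> A, x = \sum_(i < n) c i *: g i.

Definition noetherian : Prop := forall I : submodClosed A^o, fin_gen (submod I).

Definition maximal_ideal (m : idealr A) : Prop :=
  forall J : idealr A, {subset m <= J} -> {subset J <= m}.

Definition local_ring : Prop :=
  exists m : idealr A, maximal_ideal m /\
    forall m' : idealr A, maximal_ideal m' -> m' =i m.

Definition dim_ge (n : nat) : Prop :=
  exists p : nat -> prime_idealr A, forall i, (i < n)%N ->
    {subset p i <= p i.+1} /\ ~ {subset p i.+1 <= p i}.

Definition krull_dim_eq (d : nat) : Prop := forall n, dim_ge n <-> (n <= d)%N.

(* x belongs to the submodule (s_0, ..., s_(k-1)) M *)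
Definition in_ideal_mul (M : lmodType A) (s : seq A) (x : M) : Prop :=
  exists y : nat -> M, x = \sum_(i < size s) s`_i *: y i.

Definition regular_seq (M : lmodType A) (s : seq A) : Prop :=
  (forall i, (i < size s)%N -> forall x : M,
     in_ideal_mul (take i s) (s`_i *: x) -> in_ideal_mul (take i s) x) /\
  (exists x : M, ~ in_ideal_mul s x).

(* [depth_ge M n] says that depth M >= n for M over a local ring A, depth     *)
(* being the supremum of the lengths of the M-regular sequences in the        *)
(* (unique) maximal ideal m of A, with depth 0 = oo.                          *)
Definition depth_ge (M : lmodType A) (n : nat) : Prop :=
  (forall x : M, x = 0) \/
  exists m : idealr A, maximal_ideal m /\
    exists s : seq A, [/\ size s = n, {subset s <= m} & regular_seq M s].

End Finiteness.

(* depth A_p = dim A_p for every prime p *)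
Definition cohen_macaulay (A : comNzRingType) : Prop :=
  forall p : prime_idealr A, forall n,
    depth_ge (localization p)^o n <-> dim_ge (localization p) n.

Section Gorenstein.
Variable A : comNzRingType.

Definition injective_module (E : lmodType A) : Prop :=
  forall (M N : lmodType A) (i : {linear M -> N}) (g : {linear M -> E}),
    injective i -> exists h : {linear N -> E}, forall x, h (i x) = g x.

(* an injective resolution 0 -> M -> E 0 -> E 1 -> ... of finite length *)
Definition finite_inj_dim (M : lmodType A) : Prop :=
  exists (E : nat -> lmodType A) (e : {linear M -> E 0%N})
         (d : forall i, {linear E i -> E i.+1}),
    [/\ forall i, injective_module (E i),
        injective e,
        forall y, d 0%N y = 0 <-> exists x, e x = y,
        forall i y, d i.+1 y = 0 <-> exists x, d i x = y
      & exists n, forall i, (n < i)%N -> forall y : E i, y = 0].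

End Gorenstein.

(* the definition for a local ring A *)
Definition gorenstein (A : comNzRingType) : Prop := finite_inj_dim A^o.

Definition associated_prime (A : comNzRingType) (p : prime_idealr A) : Prop :=
  exists x : A, forall a, (a \in p) <-> a * x = 0.

Definition generically_gorenstein (A : comNzRingType) : Prop :=
  forall p : prime_idealr A, associated_prime p -> gorenstein (localization p).

Definition CM (A : comNzRingType) (M : lmodType A) : Prop :=
  fin_gen M /\ forall p : prime_idealr A, forall n,
    dim_ge (localization p) n -> depth_ge (localization_mod p M) n.

Definition Ref (A : comNzRingType) (M : lmodType A) : Prop :=
  fin_gen M /\ bijective (@biduality A M).

Definition regular_ideal (A : comNzRingType) (I : submodClosed A^o) : Prop :=
  exists2 a : A, a \in I & a \in nonzerodivisors A.

Definition stable_ideal (A : comNzRingType) (I : submodClosed A^o) : Prop :=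
  regular_ideal I /\ isomorphic (submod I) (hom_mod (submod I) (submod I)).

Section Conductor.
Variables (R : comNzRingType) (S : subringClosed (total_fractions R)).
Notation Q := (total_fractions R).

Definition in_conductor (q : Q) : Prop :=
  forall x : Q, x \in S -> exists a : R, q * x = to_loc _ a.

(* The conductor as an ideal of R: it is contained in R because 1 \in S, so it *)
(* is identified with its preimage in R.                                       *)
Definition conductor_pred : {pred R^o} :=
  [pred a : R | `[< in_conductor (to_loc _ a) >]].

Lemma conductor_closed : submod_closed conductor_pred.
Proof.
split; first by rewrite inE; apply/asboolP => x _; exists 0; rewrite raddf0 mul0r.
move=> c a b; rewrite !inE => /asboolP ha /asboolP hb; apply/asboolP => x xS.
have [a' ea] := ha x xS; have [b' eb] := hb x xS.
by exists (c * a' + b'); rewrite !rmorphD !rmorphM mulrDl -mulrA ea eb.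
Qed.

HB.instance Definition _ :=
  GRing.isSubmodClosed.Build R R^o conductor_pred conductor_closed.

Definition conductor : submodClosed R^o := conductor_pred.

End Conductor.

(* Main.v *)
(** Fix a non-zero-divisor d of R with dS contained in R, and let C be the
    conductor, so that C = Hom_R(S, R) as a fractional ideal.  Conditions (1)
    and (2) both amount to C being principal, C = uS with u regular: if S is
    reflexive then Hom_R(C, C) = S, and an isomorphism of C with Hom_R(C, C), or
    of S with C, is determined by a generator.  If C = uS then, for every
    S-module M, Hom_R(M, R) = Hom_S(M, C) = u Hom_S(M, S), whence M is reflexive
    over R if and only if it is over S; and a torsion-free finite S-module is
    Cohen-Macaulay.

    Conversely, under (3) both S and C are reflexive over R (the latter since
    R : C = S), hence C is reflexive over S.  The trace ideal J = C (S : C)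
    satisfies S : J = (S : (S : C)) : C = C : C = S, which forces J = S because
    S has dimension 1; so C is invertible over the semilocal ring S, hence
    principal. *)
From HB Require Import structures.
Require Import Defs.
From mathcomp Require Import all_boot all_algebra ring_quotient.
From mathcomp Require Import ring boolp.

Set Implicit Arguments.
Unset Strict Implicit.
Unset Printing Implicit Defensive.

Import GRing.Theory.
Local Open Scope ring_scope.

(** * Ideals and primes of a Noetherian ring *)

Section Packaging.
Variables (A : comNzRingType) (M : lmodType A) (P : M -> Prop).
Hypotheses (P0 : P 0) (PD : forall a x y, P x -> P y -> P (a *: x + y)).

Definition submod_pred : {pred M} := [pred x | `[< P x >]].

Lemma submod_predP x : reflect (P x) (x \in submod_pred).
Proof. exact: asboolP. Qed.

Lemma submod_pred_closed : submod_closed submod_pred.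
Proof.
split=> [|a x y]; first exact/submod_predP.
by move=> /submod_predP px /submod_predP py; apply/submod_predP/PD.
Qed.

HB.instance Definition _ :=
  GRing.isSubmodClosed.Build A M submod_pred submod_pred_closed.

Definition submod_of : submodClosed M := submod_pred.

End Packaging.

Section Ideals.
Variable A : comNzRingType.
Implicit Types I J P T : A -> Prop.

(** The unit ideal is allowed here, whereas an [idealr] is proper; sums and principal ideals may be
    improper. *)
Definition is_ideal I := I 0 /\ forall a x y, I x -> I y -> I (a * x + y).

Definition is_prime I :=
  [/\ is_ideal I, ~ I 1 & forall x y, I (x * y) -> I x \/ I y].

Lemma ideal0 I : is_ideal I -> I 0. Proof. by case. Qed.

Lemma idealD I x y : is_ideal I -> I x -> I y -> I (x + y).
Proof. by move=> [_ h] ix iy; rewrite -[x]mul1r; apply: h. Qed.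

Lemma ideal_mull I a x : is_ideal I -> I x -> I (a * x).
Proof. by move=> [h0 h] ix; rewrite -[_ * _]addr0; apply: h. Qed.

Lemma ideal_mulr I a x : is_ideal I -> I x -> I (x * a).
Proof. by rewrite mulrC; apply: ideal_mull. Qed.

Lemma idealB I x y : is_ideal I -> I x -> I y -> I (x - y).
Proof.
by move=> hI ix iy; rewrite -mulN1r; apply: idealD => //; apply: ideal_mull.
Qed.

Lemma idealDl I x y : is_ideal I -> I y -> I (x + y) -> I x.
Proof. by move=> hI iy /idealB/(_ iy); rewrite addrK; apply. Qed.

Lemma ideal_sum I n (c g : 'I_n -> A) :
  is_ideal I -> (forall i, I (g i)) -> I (\sum_i c i * g i).
Proof.
move=> hI ig; elim/big_ind: _ => [|x y|i _]; first exact: ideal0.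
  exact: idealD.
exact: ideal_mull.
Qed.

Lemma ideal_add I J : is_ideal I -> is_ideal J ->
  is_ideal (fun z => exists x y, [/\ I x, J y & z = x + y]).
Proof.
move=> hI hJ; split.
  by exists 0, 0; split; rewrite ?addr0 //; apply: ideal0.
move=> a _ _ [x [y [ix jy ->]]] [x' [y' [ix' jy' ->]]].
exists (a * x + x'), (a * y + y'); split; [exact: hI.2|exact: hJ.2|ring].
Qed.

Lemma ideal_principal x : is_ideal (fun z => exists y, z = x * y).
Proof.
split; first by exists 0; rewrite mulr0.
by move=> a _ _ [y ->] [z ->]; exists (a * y + z); ring.
Qed.

Lemma prime_spec (p : prime_idealr A) : is_prime (fun x => x \in p).
Proof.
split=> [||x y]; last by rewrite prime_idealrM => /orP.
  split=> [|a x y xp yp]; first exact: idealr0.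
  by rewrite rpredD // idealMr.
by rewrite idealr1.
Qed.

Lemma idealr_spec (p : idealr A) : is_ideal (fun x => x \in p).
Proof.
split=> [|a x y xp yp]; first exact: idealr0.
by rewrite rpredD // idealMr.
Qed.

Section Pack.
Variable P : A -> Prop.
Definition ideal_pred : {pred A} := [pred x | `[< P x >]].

Hypothesis Pp : is_prime P.

Lemma ideal_pred_closed : idealr_closed ideal_pred.
Proof.
case: Pp => hP P1 PM; split=> [||a x y].
- by apply/asboolP; exact: ideal0.
- exact/asboolP.
- by move=> /asboolP px /asboolP py; apply/asboolP; apply: hP.2.
Qed.

Lemma ideal_pred_prime : prime_idealr_closed ideal_pred.
Proof.
by case: Pp => hP P1 PM u v /asboolP/PM[]/asboolP h; apply/orP; [left|right].
Qed.

HB.instance Definition _ := isIdealr.Build A ideal_pred ideal_pred_closed.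
HB.instance Definition _ :=
  isPrimeIdealrClosed.Build A ideal_pred ideal_pred_prime.

Definition prime_of : prime_idealr A := ideal_pred.

Lemma prime_ofE x : (x \in prime_of) = `[< P x >].
Proof. by []. Qed.

End Pack.

Section PackIdeal.
Variable P : A -> Prop.
Hypotheses (hP : is_ideal P) (P1 : ~ P 1).

Lemma ideal_pred_idealr : idealr_closed (ideal_pred P).
Proof.
split=> [||a x y]; [by apply/asboolP; exact: ideal0 | exact/asboolP |].
by move=> /asboolP px /asboolP py; apply/asboolP; apply: hP.2.
Qed.

Let I := ideal_pred P.
HB.instance Definition _ := isIdealr.Build A I ideal_pred_idealr.

Definition idealr_of : idealr A := I.

End PackIdeal.

Lemma noetherian_fg I : noetherian A -> is_ideal I ->
  exists n (g : 'I_n -> A), (forall i, I (g i)) /\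
    forall x, I x -> exists c, x = \sum_i c i * g i.
Proof.
move=> noethA hI.
pose N := @submod_of A A^o I hI.1 hI.2.
have [n [g hg]] := noethA N.
exists n, (fun i => submod_val (g i)); split=> [i|x ix].
  exact/asboolP/(submod_valP (g i)).
have xN : x \in N by apply/asboolP.
have [c /(congr1 (@submod_val _ _ _)) /= e] := hg (Submod xN).
exists c; rewrite e.
by rewrite (big_morph (@submod_val _ _ N) (fun _ _ => erefl) erefl).
Qed.

(** Otherwise choice builds a strictly increasing sequence in [F] above [I]. Its union is finitely
    generated, so one term contains all the generators and cannot grow. *)
Lemma noetherian_max (F : (A -> Prop) -> Prop) I : noetherian A ->
  (forall J, F J -> is_ideal J) -> F I ->
  exists J, [/\ F J, (forall x, I x -> J x) &
    forall K, F K -> (forall x, J x -> K x) -> forall x, K x -> J x].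
Proof.
move=> noethA Fid FI; apply: contrapT => nomax.
pose W := {J | F J /\ forall x, I x -> J x}.
have step (w : W) : exists w' : W,
    (forall x, sval w x -> sval w' x) /\ exists x, sval w' x /\ ~ sval w x.
  apply: contrapT => noW; apply: nomax; exists (sval w).
  have [FJ IJ] := svalP w; split=> // K FK JK x Kx.
  apply: contrapT => nx; apply: noW.
  have hK : F K /\ forall x, I x -> K x by split=> // y /IJ/JK.
  by exists (exist _ K hK); split=> //; exists x.
have [next hnext] := choice step.
have hI : F I /\ forall x, I x -> I x by [].
pose u n := sval (iter n next (exist _ I hI : W)).
have mono m n : (m <= n)%N -> forall x, u m x -> u n x.
  move=> /subnK <-; elim: (n - m)%N => // k IHk x /IHk.
  by rewrite /u addSn /=; apply: (hnext _).1.
have uid n : is_ideal (u n) by apply/Fid; case: (svalP (iter n next (exist _ I hI))).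
pose U x := exists n, u n x.
have hU : is_ideal U.
  split; first by exists 0%N; apply: (uid 0%N).1.
  move=> a x y [m ux] [n uy]; exists (maxn m n); apply: (uid _).2.
    exact: (mono _ _ (leq_maxl _ _) _ ux).
  exact: (mono _ _ (leq_maxr _ _) _ uy).
have [n [g [Ug gen]]] := noetherian_fg noethA hU.
have [k hk] := choice Ug.
pose N := (\max_i k i)%N.
have [x [ux nux]] := (hnext (iter N next (exist _ I hI : W))).2.
apply: nux; have [|c ->] := gen x; first by exists N.+1.
apply: (ideal_sum _ (uid N)) => i; exact: (mono _ _ (leq_bigmax _) _ (hk i)).
Qed.

(** [P] is maximal among the ideals above [I] disjoint from [T]. For [x], [y] outside [P], both
    [P + xA] and [P + yA] meet [T]; the product of the two meeting elements would lie in [P] if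
    [x * y] did. *)
Lemma ideal_prime_above T I : noetherian A ->
  T 1 -> (forall x y, T x -> T y -> T (x * y)) ->
  is_ideal I -> (forall x, I x -> ~ T x) ->
  exists P, [/\ is_prime P, (forall x, I x -> P x), (forall x, P x -> ~ T x) &
   forall J, is_ideal J -> (forall x, J x -> ~ T x) ->
     (forall x, P x -> J x) -> forall x, J x -> P x].
Proof.
move=> noethA T1 TM hI IT.
have [|//|P [[hP PT] IP Pmax]] := @noetherian_max
  (fun J => is_ideal J /\ forall x, J x -> ~ T x) I noethA; first by move=> J [].
exists P; split=> //; last by move=> J hJ JT; apply: Pmax.
have meets x : ~ P x -> exists p a, P p /\ T (p + x * a).
  move=> nPx; apply: contrapT => no; apply: nPx.
  have hJ := ideal_add hP (ideal_principal x).
  apply: (Pmax _ _ _); first split; first exact: hJ.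
  - move=> _ [p [_ [pp [a ->] ->]]] t; apply: no; by exists p, a.
  - by move=> y py; exists y, 0; split; rewrite ?addr0 //; exists 0; rewrite mulr0.
  - by exists 0, x; split; rewrite ?add0r //; [exact: hP.1|exists 1; rewrite mulr1].
split=> // [|x y Pxy]; first by move=> /PT.
apply: contrapT => /not_orP[/meets[p [a [pp tx]]] /meets[q [b [pq ty]]]].
apply: (PT _ _ (TM _ _ tx ty)).
have -> : (p + x * a) * (q + y * b) =
  (q + y * b) * p + ((x * a) * q + (a * b) * (x * y)) by ring.
by apply: hP.2 => //; apply: hP.2 => //; apply: ideal_mull.
Qed.

End Ideals.

(** * Determinants and finite extensions *)

Section Determinant.
Variables (A : comNzRingType).

(** Cramer's rule: multiply the system by the adjugate. *)
Lemma det_scale_family (M : lmodType A) n (T : 'M[A]_n) (v w : 'I_n -> M) :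
  (forall i, \sum_j T i j *: v j = w i) ->
  forall i, \det T *: v i = \sum_j \adj T i j *: w j.
Proof.
move=> Tv i.
under [RHS]eq_bigr => j _.
  rewrite -Tv scaler_sumr; under eq_bigr => k _ do rewrite scalerA.
  over.
rewrite exchange_big /= (bigD1 i) //= [X in _ + X]big1 => [|k ki].
  rewrite addr0 -scaler_suml; congr (_ *: _).
  by move/matrixP/(_ i i): (mul_adj_mx T); rewrite !mxE eqxx mulr1n => ->.
rewrite -scaler_suml.
move/matrixP/(_ i k): (mul_adj_mx T).
by rewrite !mxE eq_sym (negPf ki) mulr0n => ->; rewrite scale0r.
Qed.

(** The determinant of [1 - X C] is a polynomial in [X] with constant term [det 1 = 1]; evaluate it
    at [t]. *)
Lemma det_one_sub n (t : A) (C : 'M[A]_n) :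
  exists b, \det (1%:M - t *: C) = 1 - t * b.
Proof.
pose D : 'M[{poly A}]_n := 1%:M - 'X *: map_mx polyC C.
have horner_det (s : A) : \det (1%:M - s *: C) = (\det D).[s].
  rewrite -[RHS]horner_evalE -det_map_mx; congr (\det _).
  by apply/matrixP => i j; rewrite !mxE /= /horner_eval !(hornerMn, hornerE).
have [q hq] : exists q, \det D = q * 'X + ((\det D).[0])%:P.
  have /factor_theorem[q hq] : root (\det D - ((\det D).[0])%:P) 0.
    by rewrite /root !hornerE subrr.
  by exists q; apply/eqP; rewrite -subr_eq hq subr0.
exists (- q.[t]); rewrite horner_det hq !hornerE -horner_det.
by rewrite scale0r subr0 det1; ring.
Qed.

(** Determinant trick: the generators satisfy [(1 - t C) g = 0], so the unit [det (1 - t C)] kills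
    them. *)
Lemma nakayama (M : lmodType A) (t : A) : fin_gen M ->
  (forall b, exists b', (1 - t * b) * b' = 1) ->
  (forall x : M, exists y, x = t *: y) -> forall x : M, x = 0.
Proof.
move=> [n [g gen]] tu tM.
have gt i : exists c : 'I_n -> A, g i = t *: \sum_j c j *: g j.
  by have [y ->] := tM (g i); have [c ->] := gen y; exists c.
have [c hc] := choice gt.
pose C : 'M[A]_n := \matrix_(i, j) c i j.
have g0 i : g i = 0.
  have := @det_scale_family M n (1%:M - t *: C) g (fun=> 0) _ i.
  have [b ->] := det_one_sub t C; have [b' hb] := tu b.
  move=> h; rewrite -[LHS]scale1r -hb mulrC -scalerA h.
    by rewrite big1 ?scaler0 // => j _; rewrite scaler0.
  move=> k; under eq_bigr => j _ do rewrite !mxE scalerBl -scalerA.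
  rewrite sumrB -scaler_sumr -hc (bigD1 k) //= eqxx scale1r big1 ?addr0 ?subrr //.
  by move=> j jk; rewrite eq_sym (negPf jk) scale0r.
move=> x; have [d ->] := gen x.
by rewrite big1 // => i _; rewrite g0 scaler0.
Qed.

End Determinant.

Section FiniteExtension.
Variables (A B : comNzRingType) (phi : {rmorphism A -> B}).
Hypothesis finB : fin_gen (restr phi B^o).

Lemma fin_ext_gen : exists n (g : 'I_n -> B),
  forall x, exists c, x = \sum_i phi (c i) * g i.
Proof. exact: finB. Qed.

(** With [C] the matrix of multiplication by [x] on generators of [B], [det (x - C)] kills the
    generators, hence kills 1. *)
Lemma fin_ext_integral (x : B) :
  exists2 f : {poly A}, f \is monic & (map_poly phi f).[x] = 0.
Proof.
have [n [g gen]] := fin_ext_gen.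
have [c hc] := choice (fun i => gen (x * g i)).
pose C : 'M[A]_n := \matrix_(i, j) c i j.
exists (char_poly C); first exact: char_poly_monic.
rewrite map_char_poly.
have e : \det (x%:M - map_mx phi C) = (char_poly (map_mx phi C)).[x].
  rewrite /char_poly /char_poly_mx -[RHS]horner_evalE -det_map_mx.
  congr (\det _); apply/matrixP => i j.
  by rewrite !mxE /= /horner_eval !(hornerMn, hornerE).
rewrite -e.
have d0 i : \det (x%:M - map_mx phi C) * g i = 0.
  rewrite [LHS](@det_scale_family B B^o n _ g (fun=> 0)).
    by rewrite big1 // => j _; rewrite scaler0.
  move=> k; under eq_bigr => j _ do rewrite !mxE scalerBl.
  rewrite sumrB (bigD1 k) //= eqxx mulr1n big1 ?addr0.
    by apply/eqP; rewrite subr_eq0; apply/eqP; rewrite [LHS]hc.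
  by move=> j jk; rewrite eq_sym (negPf jk) mulr0n scale0r.
have [d hd] := gen 1.
rewrite -[LHS]mulr1 hd mulr_sumr big1 // => i _.
by rewrite mulrCA d0 mulr0.
Qed.

(** The Jacobson radical of [A] maps into that of [B]: with [C] as for integrality, the unit
    [det (1 - t C)] times any generator is a multiple of [1 - phi t * x], and 1 is a combination of
    generators. *)
Lemma fin_ext_one_sub_unit (t : A) :
  (forall a, exists a', (1 - t * a) * a' = 1) ->
  forall x, exists y, (1 - phi t * x) * y = 1.
Proof.
move=> tu x; have [n [g gen]] := fin_ext_gen.
have [c hc] := choice (fun i => gen (x * g i)).
pose C : 'M[A]_n := \matrix_(i, j) c i j.
have [b hb] := det_one_sub t C; have [b' hb'] := tu b.
have d0 i : phi (1 - t * b) * g i =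
    (1 - phi t * x) * \sum_j phi (\adj (1%:M - t *: C) i j) * g j.
  have := @det_scale_family A (restr phi B^o) n (1%:M - t *: C) g
    (fun k => (1 - phi t * x) * g k).
  move=> /(_ _ i); rewrite hb => h; rewrite [LHS]h.
    rewrite mulr_sumr; apply: eq_bigr => j _.
    by rewrite [LHS]mulrCA.
  move=> k; under eq_bigr => j _ do rewrite !mxE scalerBl -scalerA.
  rewrite sumrB -scaler_sumr (bigD1 k) //= eqxx scale1r big1 ?addr0; last first.
    by move=> j jk; rewrite eq_sym (negPf jk) scale0r.
  rewrite mulrBl mul1r -mulrA hc.
  by congr (_ - _).
have [d hd] := gen 1.
exists (phi b' * \sum_i phi (d i) * \sum_j phi (\adj (1%:M - t *: C) i j) * g j).
rewrite mulrCA mulr_sumr.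
under eq_bigr => i _ do rewrite mulrCA -d0 mulrCA.
by rewrite -mulr_sumr -hd mulr1 -rmorphM mulrC hb' rmorph1.
Qed.

(* A relation [f x = 0] modulo p with a coefficient outside p can be divided *)
(* by x until its constant term lies outside p.                              *)
Lemma fin_ext_meets_base (p : B -> Prop) (x : B) : is_prime p -> ~ p x ->
  exists a y, ~ p (phi a) /\ p (phi a - x * y).
Proof.
move=> [hp p1 pM] npx.
have [f fmon fx] := fin_ext_integral x.
have : p (map_poly phi f).[x] by rewrite fx; apply: hp.1.
have : exists i, ~ p (phi f`_i).
  by exists (size f).-1; rewrite -/(lead_coef f) (monicP fmon) rmorph1.
elim/poly_ind: f {fmon fx} => [[i]|f c IHf [i ni] pf].
  by rewrite coef0 rmorph0 => /(_ hp.1).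
have {}pf : p (x * (map_poly phi f).[x] + phi c).
  by move: pf; rewrite rmorphD rmorphM /= map_polyX map_polyC !hornerE mulrC.
have [pc|npc] := pselect (p (phi c)); last first.
  exists c, (- (map_poly phi f).[x]); split=> //.
  by rewrite mulrN opprK addrC.
apply: IHf; last first.
  by have /pM[] := idealDl hp pc pf.
case: i ni => [|i] ni; last by exists i; move: ni; rewrite coefD coefMX coefC /= addr0.
by case: ni; rewrite coefD coefMX coefC /= add0r.
Qed.

End FiniteExtension.

(** * Local rings, chains of primes and localization *)

Section LocalRings.
Variable A : comNzRingType.

Definition is_local_ideal (m : A -> Prop) :=
  is_prime m /\ forall x, ~ m x -> exists y, x * y = 1.

Lemma local_ideal_proper m I : is_local_ideal m -> is_ideal I -> ~ I 1 ->
  forall x, I x -> m x.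
Proof.
move=> [_ um] hI I1 x Ix; apply: contrapT => /um[y e].
by apply: I1; rewrite -e; apply: ideal_mulr.
Qed.

Lemma local_ideal_maximal m : is_local_ideal m ->
  exists2 n : idealr A, maximal_ideal n & forall x, x \in n <-> m x.
Proof.
move=> hm; have [[hI m1 _] _] := hm.
have memE x : (x \in idealr_of hI m1) <-> m x by split=> /asboolP.
exists (idealr_of hI m1) => // J _ x xJ; apply/memE.
apply: (local_ideal_proper hm (idealr_spec J)) => //.
by rewrite idealr1.
Qed.

Lemma local_ideal_unique m (n : idealr A) : is_local_ideal m ->
  maximal_ideal n -> forall x, x \in n <-> m x.
Proof.
move=> hm hn x; split.
  move=> xn; apply: (local_ideal_proper hm (idealr_spec n)) => //.
  by rewrite idealr1.
have [n' _ n'E] := local_ideal_maximal hm.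
move=> /n'E; apply: hn => y yn; apply/n'E.
by apply: (local_ideal_proper hm (idealr_spec n)) => //; rewrite idealr1.
Qed.

(** A proper ideal lies in a prime maximal among the ideals avoiding 1, which is [m] by uniqueness.
    For [m] itself this gives primality, for [xA] that elements outside [m] are units. *)
Lemma local_ring_ideal : noetherian A -> local_ring A ->
  exists m, is_local_ideal m.
Proof.
move=> noethA [m [mmax muniq]].
have above (I : A -> Prop) : is_ideal I -> ~ I 1 ->
    is_prime (fun x => x \in m) /\ forall x, I x -> x \in m.
  move=> hI I1.
  have [| | | |P [hP IP PT Pmax]] := @ideal_prime_above _ (fun x => x = 1) I noethA.
  - by [].
  - by move=> _ _ -> ->; rewrite mulr1.
  - by [].
  - by move=> x Ix e; apply: I1; rewrite -e.
  have PE x : x \in prime_of hP <-> P x by split=> /asboolP.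
  have Pm : prime_of hP =i m.
    apply: muniq => J PJ x xJ; apply/PE; apply: (Pmax (fun x => x \in J)) => //.
    - exact: idealr_spec.
    - by move=> y yJ y1; move: yJ; rewrite y1 idealr1.
    - by move=> y /PE/PJ.
  have PE' x : x \in m <-> P x by rewrite -Pm.
  have <- : P = (fun x => is_true (x \in m)).
    by apply/funext => x; apply/propext; rewrite PE'.
  by split=> // x /IP/PE'.
exists (fun x => is_true (x \in m)); split.
  have m1 : ~ (1 \in m) by rewrite idealr1.
  by have [] := above _ (idealr_spec m) m1.
move=> x nx; apply: contrapT => nu; apply/nx.
have [|_] := above _ (ideal_principal x).
  by move=> [y e]; apply: nu; exists y.
by apply; exists 1; rewrite mulr1.
Qed.

Lemma dim_geP n : dim_ge A n <-> exists p : nat -> A -> Prop,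
  (forall i, is_prime (p i)) /\ forall i, (i < n)%N ->
    (forall x, p i x -> p i.+1 x) /\ exists2 x, p i.+1 x & ~ p i x.
Proof.
split=> [[p hp]|[p [pp hp]]].
  exists (fun i x => x \in p i); split=> [i|i /hp[sub nsub]].
    exact: prime_spec.
  split=> //; apply: contrapT => no; apply: nsub => x xp.
  by apply: contrapT => nx; apply: no; exists x.
exists (fun i => prime_of (pp i)) => i /hp[sub [x px npx]]; split.
  by move=> y /asboolP/sub h; apply/asboolP.
by move=> /(_ x); rewrite !prime_ofE => /(_ (asboolT px))/asboolP.
Qed.

(* No product t^k s with s outside q vanishes, so q strictly contains a *)
(* prime avoiding t; if q were smaller than m, A would have dimension 2. *)
Lemma prime_nzd_maximal m q t : noetherian A -> ~ dim_ge A 2 ->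
  is_local_ideal m -> is_prime q -> q t -> GRing.lreg t ->
  forall x, m x -> q x.
Proof.
move=> noethA dimA hm hq qt rt x mx; apply: contrapT => nqx.
have [[hI _ _] _] := hm; have [qI q1 qM] := hq.
pose T x := exists k s, ~ q s /\ x = t ^+ k * s.
have [| | | |P [hP _ PT _]] := @ideal_prime_above _ T (fun x => x = 0) noethA.
- by exists 0%N, 1; rewrite expr0 mulr1.
- move=> _ _ [k [s [ns ->]]] [l [r [nr ->]]]; exists (k + l)%N, (s * r).
  by split; [move=> /qM[]|rewrite exprD; ring].
- by split=> // a _ _ -> ->; rewrite mulr0 addr0.
- move=> _ -> [k [s [ns e]]]; apply: ns.
  have -> : s = 0 by apply: (lregX (n := k) rt); rewrite mulr0 -e.
  exact: ideal0.
apply/dimA/dim_geP.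
exists (fun i => if i is i'.+1 then if i' is 0%N then q else m else P).
split=> [[|[|i]] //|[|[|i]] // _]; first exact: hm.1; split.
- move=> y Py; apply: contrapT => nq; apply: (PT _ Py).
  by exists 0%N, y; rewrite expr0 mul1r.
- exists t => // Pt; apply: (PT _ Pt); exists 1%N, 1.
  by rewrite expr1 mulr1.
- exact: local_ideal_proper.
- by exists x.
Qed.

End LocalRings.

Lemma prime_preim (A B : comNzRingType) (f : {rmorphism A -> B}) p :
  is_prime p -> is_prime (fun x => p (f x)).
Proof.
move=> [hp p1 pM]; split.
- split; first by rewrite rmorph0; apply: hp.1.
  by move=> a x y px py; rewrite rmorphD rmorphM; apply: hp.2.
- by rewrite rmorph1.
- by move=> x y; rewrite rmorphM => /pM.
Qed.

Section LocalizedPrimes.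
Variables (A : comNzRingType) (T : multset A).

Definition ext_ideal (p : A -> Prop) (x : loc_ring T) :=
  exists a s, p a /\ x = ringfrac a s.

Lemma ringfrac_unit (s t : denom T) :
  ringfrac (denom_val s) t * ringfrac (denom_val t) s = 1.
Proof.
rewrite ringfrac_mul; apply/ringfrac_eqP; exists (denom1 T) => /=; ring.
Qed.

Lemma ringfracE a (s : denom T) :
  to_loc T a = ringfrac a s * to_loc T (denom_val s).
Proof.
rewrite ringfrac_mul; apply/ringfrac_eqP; exists (denom1 T) => /=; ring.
Qed.

Lemma ringfrac_split a (s : denom T) :
  ringfrac a s = to_loc T a * ringfrac 1 s.
Proof.
rewrite ringfrac_mul; apply/ringfrac_eqP; exists (denom1 T) => /=; ring.
Qed.

Section Prime.
Variable p : A -> Prop.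
Hypotheses (hp : is_prime p) (pT : forall s : denom T, ~ p (denom_val s)).

Lemma ext_idealE a s : ext_ideal p (ringfrac a s) <-> p a.
Proof.
split=> [[b [t [pb /ringfrac_eqP[u e]]]]|pa]; last by exists a, s.
have [hI p1 pM] := hp.
have : p (u * t * a) by rewrite e; apply: ideal_mull.
by move=> /pM[/pM[]/pT|].
Qed.

Lemma ext_ideal_prime : is_prime (ext_ideal p).
Proof.
have [hI p1 pM] := hp; split.
- split; first by apply/(ext_idealE 0 (denom1 T)); apply: hI.1.
  move=> x y z; have [a [s ->]] := ringfracP x; have [b [t ->]] := ringfracP y.
  have [c [u ->]] := ringfracP z; rewrite ringfrac_mul ringfrac_add.
  rewrite !ext_idealE => pb pc; apply: idealD => //; do ?exact: ideal_mull.
  by rewrite mulrA; apply: ideal_mull.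
- by move=> /(ext_idealE 1 (denom1 T)).
- move=> x y; have [a [s ->]] := ringfracP x; have [b [t ->]] := ringfracP y.
  by rewrite ringfrac_mul !ext_idealE; apply: pM.
Qed.

End Prime.
End LocalizedPrimes.

Lemma prime_compl_notin (A : comNzRingType) (p : prime_idealr A)
  (s : denom (prime_compl p)) : ~ (@denom_val A _ s \in p).
Proof. by have := denomP s; rewrite inE => /negP. Qed.

Lemma localization_local (A : comNzRingType) (p : prime_idealr A) :
  is_local_ideal (@ext_ideal A (prime_compl p) (fun x => x \in p)).
Proof.
have hp := prime_spec p; split.
  by apply: ext_ideal_prime => // s; apply: prime_compl_notin.
move=> x; have [a [s ->]] := ringfracP x => nx.
have na : a \in prime_compl p.
  by rewrite inE; apply/negP => pa; apply: nx; exists a, s.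
by exists (ringfrac (denom_val s) (Denom na)); apply: (ringfrac_unit (Denom na) s).
Qed.

(** The localization at [m] has dimension, hence depth, at least 1. The numerator of a regular
    element of its maximal ideal is regular in [A], elements outside [m] being units. *)
Lemma exists_nonzerodivisor (A : comNzRingType) (m : A -> Prop) : noetherian A ->
  is_local_ideal m -> cohen_macaulay A -> dim_ge A 1 ->
  exists2 t, m t & GRing.lreg t.
Proof.
move=> noethA hm cmA /dim_geP[q [hq /(_ 0%N isT)[q01 [x q1x nq0x]]]].
have [mp mu] := hm; pose P := prime_of mp.
have PE y : y \in P <-> m y by split=> /asboolP.
have qm i y : q i y -> m y.
  by have [hI q1 _] := hq i; apply: local_ideal_proper.
have qP i (s : denom (prime_compl P)) : ~ q i (denom_val s).
  by move=> /qm/PE; apply: prime_compl_notin.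
have : dim_ge (localization P) 1.
  apply/dim_geP; exists (fun i => @ext_ideal A (prime_compl P) (q i)); split.
    by move=> i; apply: ext_ideal_prime.
  case=> // _; split.
    by move=> _ [a [s [qa ->]]]; exists a, s; split=> //; apply: q01.
  exists (ringfrac x (denom1 (prime_compl P))); first by exists x, (denom1 _).
  by move/(ext_idealE (hq 0%N) (@qP 0%N)).
move=> /cmA[/(_ 1)/eqP|[n [nmax [s [ss sn [reg _]]]]]].
  by rewrite oner_eq0.
case: s ss sn reg => [|y [|]] // _ sn reg.
have ny : y \in n by apply: sn; rewrite inE.
have yE := (local_ideal_unique (localization_local P) nmax y).1 ny.
have [t [s [/PE mt eyt]]] := yE.
exists t => //; apply: mulrI0_lreg => a ta.
have [] := reg 0%N isT (to_loc _ a); rewrite /= ?big_ord0.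
  exists (fun=> 0); rewrite big_ord0 eyt [LHS]ringfrac_mul ta.
  by apply/ringfrac_eqP; exists (denom1 _); rewrite /= !mulr0.
move=> z; rewrite big_ord0 => /ringfrac_eqP[u]; rewrite /= !mulr0 mulr1.
have /mu[v uv] : ~ m (denom_val u) by move/PE; apply: prime_compl_notin.
by move=> ua; rewrite -[a]mul1r -uv mulrAC ua mul0r.
Qed.

(** * Dimension and depth of finite modules *)

Lemma dim_ge_leq (A : comNzRingType) k n : (k <= n)%N -> dim_ge A n -> dim_ge A k.
Proof. by move=> kn [p hp]; exists p => i ik; apply: hp (leq_trans ik kn). Qed.

Lemma in_ideal_mul_nil (A : comNzRingType) (M : lmodType A) (x : M) :
  in_ideal_mul [::] x <-> x = 0.
Proof.
split=> [[y ->]|->]; first by rewrite big_ord0.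
by exists (fun=> 0); rewrite big_ord0.
Qed.

Section LocalizedModule.
Variables (A : comNzRingType) (T : multset A) (M : lmodType A).

Lemma scale_locfrac (a : A) (s : denom T) (x : M) (t : denom T) :
  ringfrac a s *: locfrac x t = locfrac (a *: x) (denomM s t).
Proof. exact: loc_scaleE. Qed.

Lemma locfrac_linear (a : A) (x y : M) (s : denom T) :
  locfrac (a *: x + y) s = to_loc T a *: locfrac x s + locfrac y s.
Proof.
rewrite scale_locfrac frac_add; apply/frac_eqP; exists (denom1 T) => /=.
by rewrite !scalerDr !scalerA; congr (_ *: _ + _ *: _); ring.
Qed.

Lemma locfrac0 (s : denom T) : locfrac (0 : M) s = 0.
Proof. by apply/frac_eqP; exists (denom1 T); rewrite !scaler0. Qed.

Lemma locfrac_sum n (c : 'I_n -> A) (g : 'I_n -> M) (s : denom T) :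
  locfrac (\sum_i c i *: g i) s = \sum_i to_loc T (c i) *: locfrac (g i) s.
Proof.
elim: n c g => [|n IHn] c g; first by rewrite !big_ord0 locfrac0.
by rewrite !big_ord_recl locfrac_linear IHn.
Qed.

Lemma fin_gen_loc : fin_gen M -> fin_gen (loc T M).
Proof.
move=> [n [g gen]]; exists n, (fun i => locfrac (g i) (denom1 T)) => x.
have [y [s ->]] := fracP x; have [c ->] := gen y.
exists (fun i => ringfrac (c i) s).
rewrite locfrac_sum; apply: eq_bigr => i _; rewrite !scale_locfrac.
by apply/frac_eqP; exists (denom1 T) => /=; congr (_ *: _); ring.
Qed.

End LocalizedModule.

Section FiniteExtensionDimension.
Variables (R B : comNzRingType) (phi : {rmorphism R -> B}).
Hypothesis finB : fin_gen (restr phi B^o).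

(** Incomparability: an element of [Q] outside [P] has a multiple congruent modulo [P] to an element
    of [R] outside [P], which separates the contractions. *)
Lemma fin_ext_chain (T : multset B) (P Q : loc_ring T -> Prop) :
  is_prime P -> is_prime Q -> (forall x, P x -> Q x) -> (exists2 x, Q x & ~ P x) ->
  exists2 a, Q (to_loc T (phi a)) & ~ P (to_loc T (phi a)).
Proof.
move=> hP hQ PQ [x Qx nPx]; have [b [s xE]] := ringfracP x.
have Qb : Q (to_loc T b).
  by rewrite (ringfracE b s) -xE; apply: ideal_mulr => //; case: hQ.
have nPb : ~ P (to_loc T b).
  move=> pb; apply: nPx; rewrite xE ringfrac_split; apply: ideal_mulr => //.
  by case: hP.
have [a [y [na pay]]] := fin_ext_meets_base finB (prime_preim (to_loc T) hP) nPb.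
exists a => //; have [hQI _ _] := hQ.
have := PQ _ pay; rewrite rmorphB rmorphM => /(idealD hQI).
move=> /(_ (to_loc T b * to_loc T y)); rewrite subrK; apply.
exact: ideal_mulr.
Qed.

Variable (m : R -> Prop) (t : R).
Hypotheses (hm : is_local_ideal m) (dimR : ~ dim_ge R 2) (mt : m t).

(** Contraction to [R] keeps chains strict. If the upper prime of a chain of length 1 missed
    [phi t], its contraction would be strictly below [m], giving a chain of length 2 in [R]. *)
Lemma fin_ext_dim (T : multset B) n : dim_ge (loc_ring T) n ->
  (n < 2)%N /\ ((0 < n)%N -> exists2 P, is_prime P & P (to_loc T (phi t))).
Proof.
move=> /dim_geP[P [pP hP]].
pose q i a := P i (to_loc T (phi a)).
have pq i : is_prime (q i) by exact: (prime_preim phi (prime_preim (to_loc T) (pP i))).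
have hq i : (i < n)%N -> (forall a, q i a -> q i.+1 a) /\
    exists2 a, q i.+1 a & ~ q i a.
  by move=> /hP[sub nsub]; split; [move=> a /sub|exact: fin_ext_chain].
have n2 : (n < 2)%N.
  rewrite ltnNge; apply/negP => n2; apply: dimR; apply: dim_ge_leq n2 _.
  by apply/dim_geP; exists q.
split=> // n0; exists (P 1%N); first exact: pP.
apply: contrapT => nqt; apply/dimR/dim_geP.
exists (fun i => if i is i'.+1 then if i' is 0%N then q 1%N else m else q 0%N).
split=> [[|[|i]] //|[|[|i]] // _]; [by case: hm|exact: hq|].
have [qI q1 _] := pq 1%N.
by split; [exact: local_ideal_proper|exists t].
Qed.

(** The localizations of [B] have dimension at most 1. In dimension 1, [phi t] lies in the maximal
    ideal and is regular on the localized module, which it does not map onto itself by Nakayama. *)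
Lemma CM_of_regular (M : lmodType B) : fin_gen M ->
  (forall x : M, phi t *: x = 0 -> x = 0) -> CM M.
Proof.
move=> finM regM; split=> // p n /fin_ext_dim[n2 tP].
have [M0|nM0] := pselect (forall x : localization_mod p M, x = 0); first by left.
right; have hp := localization_local p.
have [k kmax kE] := local_ideal_maximal hp; exists k; split=> //.
case: n n2 tP => [|[|//]] _ tP.
  exists [::]; split=> //; split=> //; apply: contrapT => no; apply: nM0 => x.
  by apply: contrapT => nx; apply: no; exists x => /in_ideal_mul_nil.
have {tP}[P [hP P1 _] tP] := tP isT.
set tau := to_loc _ (phi t) in tP.
have ktau : tau \in k by apply/kE; apply: (local_ideal_proper hp hP).
exists [:: tau]; split=> //; first by move=> y; rewrite inE => /eqP->.
split=> [[|//] _ x|].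
  rewrite /= !in_ideal_mul_nil; have [y [s ->]] := fracP x.
  rewrite scale_locfrac -(locfrac0 _ (denom1 _)) => /frac_eqP[u].
  rewrite /= scaler0 mulr1 !scalerA => uty.
  apply/frac_eqP; exists u; rewrite /= mulr1 scaler0; apply: regM.
  by rewrite scalerA mulrC.
apply: contrapT => no; apply: nM0; apply: (@nakayama _ _ tau).
- exact: fin_gen_loc.
- move=> b; apply: hp.2; have [[kI k1 _] _] := hp => kb.
  apply: k1; apply: (idealDl (y := - (tau * b)) kI) => //.
  rewrite -mulrN; apply: ideal_mulr => //; exact/kE.
- move=> x; have : in_ideal_mul [:: tau] x.
    by apply: contrapT => nx; apply: no; exists x.
  by move=> [y ->]; exists (y 0%N); rewrite big_ord1.
Qed.

End FiniteExtensionDimension.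

(** * Trace ideals over a semilocal ring *)

Section PrimeProducts.
Variable A : comNzRingType.
Implicit Types (D I J p : A -> Prop) (ps qs : seq (A -> Prop)).

(* x times the product of the ideals in ps is contained in D *)
Fixpoint kills D ps x : Prop :=
  if ps is p :: ps' then forall a, p a -> kills D ps' (x * a) else D x.

Definition every (G : (A -> Prop) -> Prop) ps := all (fun p => `[< G p >]) ps.

Lemma every_impl (G H : (A -> Prop) -> Prop) ps :
  (forall p, G p -> H p) -> every G ps -> every H ps.
Proof.
by move=> GH; elim: ps => //= p ps IH /andP[/asboolP/GH/asboolT-> /IH].
Qed.

Lemma kills_cat D I J ps qs : is_ideal D -> (forall x y, I x -> J y -> D (x * y)) ->
  kills I ps 1 -> kills J qs 1 -> kills D (ps ++ qs) 1.
Proof.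
move=> hD IJ kI kJ.
have kq x : I x -> kills D qs x.
  move=> Ix; rewrite -[x]mulr1; elim: qs 1 kJ => [|q qs IHq] y /=; first exact: IJ.
  by move=> kJ a qa; rewrite -mulrA; apply/IHq/kJ.
elim: ps 1 kI => [|p ps IHp] x /=; first exact: kq.
by move=> kI a pa; apply/IHp/kI.
Qed.

(** A maximal counterexample [I] is prime: if [x * y] is in [I] but neither factor is, the products
    for [I + xA] and [I + yA] concatenate to one for [I]. But a prime is its own product. *)
Lemma noetherian_prime_product D : noetherian A -> is_ideal D ->
  exists ps, every (fun p => is_prime p /\ forall x, D x -> p x) ps /\
    kills D ps 1.
Proof.
move=> noethA hD; apply: contrapT => noD.
pose good I := exists ps, every (fun p => is_prime p /\ forall x, I x -> p x) ps /\
  kills I ps 1.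
have [J [hJ] //||I [[hI badI] _ Imax]] :=
  @noetherian_max A (fun I => is_ideal I /\ ~ good I) D noethA; first by split.
have larger x : ~ I x ->
    good (fun z => exists i y, [/\ I i, exists b, y = x * b & z = i + y]).
  move=> nx; apply: contrapT => bad; apply: nx.
  have hJ := ideal_add hI (ideal_principal x).
  apply: (Imax _ (conj hJ bad)).
    by move=> i Ii; exists i, 0; split; rewrite ?addr0 //; exists 0; rewrite mulr0.
  exists 0, x; split; rewrite ?add0r //; [exact: hI.1|exists 1; rewrite mulr1 //].
have I1 : ~ I 1 by move=> I1; apply: badI; exists [::].
have pI : is_prime I.
  split=> // x y Ixy; apply: contrapT => /not_orP[].
  move=> /larger[ps [gps kps]] /larger[qs [gqs kqs]].
  apply: badI; exists (ps ++ qs); split.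
    rewrite /every all_cat; apply/andP; split.
      apply: every_impl gps => p [hp sub]; split=> // i Ii; apply: sub.
      by exists i, 0; split; rewrite ?addr0 //; exists 0; rewrite mulr0.
    apply: every_impl gqs => p [hp sub]; split=> // i Ii; apply: sub.
    by exists i, 0; split; rewrite ?addr0 //; exists 0; rewrite mulr0.
  apply: (kills_cat hI _ kps kqs) => _ _ [i [_ [Ii [a ->] ->]]] [j [_ [Ij [b ->] ->]]].
  have -> : (i + x * a) * (j + y * b) =
    (j + y * b) * i + ((x * a) * j + (a * b) * (x * y)) by ring.
  by apply: hI.2 => //; apply: hI.2 => //; apply: ideal_mull.
apply: badI; exists [:: I]; split; last by move=> a; rewrite /= mul1r.
by rewrite /every /= andbT; apply/asboolP.
Qed.

(** The factor [I] is moved past [ps] and cancelled at the end. *)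
Lemma kills_colon D I ps x : (forall z, (forall a, I a -> D (z * a)) -> D z) ->
  (forall a, I a -> kills D ps (x * a)) -> kills D ps x.
Proof.
move=> colon; elim: ps x => [|p ps IHps] x /= h; first exact: colon.
by move=> b pb; apply: IHps => a Ia; rewrite mulrAC; apply: h.
Qed.

(** The factors are removed one by one: those comaximal with [J] through [x = x (1 - a) + x a],
    those with [(D : p) = D] by cancellation. *)
Lemma kills_mem D J ps x : is_ideal J -> (forall z, D z -> J z) ->
  every (fun p => (exists2 a, p a & J (1 - a)) \/
    forall z, (forall a, p a -> D (z * a)) -> D z) ps ->
  kills D ps x -> J x.
Proof.
move=> hJ DJ; elim: ps x => [|p ps IHps] x /=; first by move=> _ /DJ.
move=> /andP[/asboolP[[a pa Ja]|colon] hps] kx.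
  have -> : x = x * (1 - a) + x * a by ring.
  by apply: hJ.2 => //; apply/(IHps _ hps)/kx.
by apply: (IHps _ hps); apply: kills_colon colon kx.
Qed.

End PrimeProducts.

Section Semilocal.
Variable A : comNzRingType.

Definition is_max_prime (p : A -> Prop) :=
  is_prime p /\ forall x, ~ p x -> exists y, p (1 - x * y).

Lemma max_prime_sub (p q : A -> Prop) : is_max_prime p -> is_prime q ->
  (forall x, p x -> q x) -> forall x, q x -> p x.
Proof.
move=> [hp pmax] [hq q1 _] pq x qx; apply: contrapT => /pmax[y /pq].
by move=> /(idealD hq (ideal_mulr y hq qx)); rewrite addrC subrK => /q1.
Qed.

Lemma max_prime_avoid (q : A -> Prop) ps : is_prime q ->
  every (fun p => is_prime p /\ exists2 x, p x & ~ q x) ps ->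
  exists2 e, ~ q e & every (fun p => p e) ps.
Proof.
move=> [_ q1 qM]; elim: ps => [|p ps IHps] /=; first by exists 1.
move=> /andP[/asboolP[[pI _ _] [x px nqx]] hps]; have [e nqe pse] := IHps hps.
exists (x * e); first by move=> /qM[].
apply/andP; split; first by apply/asboolP; apply: ideal_mulr.
elim: ps hps pse {IHps} => //= r ps IHps /andP[/asboolP[[rI _ _] _] hps].
move=> /andP[/asboolP re pse]; apply/andP; split; last exact: IHps.
by apply/asboolP; apply: ideal_mull.
Qed.

Variable M : lmodType A.
Implicit Type f : hom_mod M A^o.

(** If [x] fails at the new ideal [q], it is corrected by [e *: y], with [f y] outside [q] and [e]
    in all the other ideals but not in [q]. *)
Lemma exists_generic ps :
  every (fun p => is_max_prime p /\ exists f x, ~ p (f x)) ps ->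
  exists x : M, every (fun p => exists f, ~ p (f x)) ps.
Proof.
elim: ps => [|q ps IHps] /=; first by exists 0.
move=> /andP[/asboolP[hq [f [y nqy]]] hps]; have [x hx] := IHps hps.
have [qx|nqx] := pselect (exists f, ~ q (f x)).
  by exists x; apply/andP; split=> //; apply/asboolP.
have {}nqx (g : hom_mod M A^o) : q (g x) by apply: contrapT => n; apply: nqx; exists g.
have [qI q1 qM] := hq.1.
(* No [p] in [ps] lies in [q]: by maximality it would equal [q], but [x] works at [p] and fails at
   [q]. *)
have [|e nqe he] := @max_prime_avoid q ps hq.1.
  elim: ps hps hx {IHps} => //= p ps IHps /andP[/asboolP[hp _] hps].
  move=> /andP[/asboolP[g npg] hx]; apply/andP; split; last exact: IHps.
  apply/asboolP; split; first exact: hp.1.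
  apply: contrapT => no; apply: npg.
  apply: (max_prime_sub hp hq.1) (nqx g) => z pz.
  by apply: contrapT => nqz; apply: no; exists z.
exists (x + e *: y); apply/andP; split.
  apply/asboolP; exists f; rewrite linearD linearZ /= => h.
  have : q (e * f y) by apply: (idealDl qI (nqx f)); rewrite addrC.
  by move=> /qM[].
elim: ps hps hx he {IHps} => //= p ps IHps /andP[/asboolP[[[pI _ _] _] _] hps].
move=> /andP[/asboolP[g npg] hx] /andP[/asboolP pe he].
apply/andP; split; last exact: IHps.
apply/asboolP; exists g; rewrite linearD linearZ /= => h; apply: npg.
exact: (idealDl pI (ideal_mulr (g y) pI pe) h).
Qed.

Variable t : A.
Hypotheses (noethA : noetherian A)
  (tjac : forall s : A, exists v : A, (1 - t * s) * v = 1)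
  (tmax : forall p, is_prime p -> p t -> is_max_prime p)
  (tval : exists f x, f x = t).
Hypothesis tcolon : forall z : A,
  (forall f x, exists b, z * f x = t * b) -> exists b, z = t * b.

(* The trace ideal J of M satisfies (tA : J) = tA, so that, tA containing a   *)
(* product of maximal ideals, J is the unit ideal.                            *)
Lemma exists_unimodular : exists f x, f x = 1.
Proof.
pose D z := exists b, z = t * b.
have hD : is_ideal D by apply: ideal_principal.
have [ps [hps kps]] := noetherian_prime_product noethA hD.
have {}hps : every is_max_prime ps.
  apply: every_impl hps => p [hp Dp]; apply: tmax => //; apply: Dp.
  by exists 1; rewrite mulr1.
(* The trace ideal, as the intersection of all ideals containing every value [f x]. *)
pose J z := forall I : A -> Prop, is_ideal I -> (forall f x, I (f x)) -> I z.
have hJ : is_ideal J.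
  split=> [I hI _|a x y Jx Jy I hI If]; first exact: hI.1.
  by apply: hI.2; [exact: Jx|exact: Jy].
have J1 : J 1.
  apply: (@kills_mem _ D J ps 1 hJ _ _ kps).
    move=> _ [b ->]; apply: (ideal_mulr b hJ) => I _ If.
    by have [f [x <-]] := tval.
  apply: every_impl hps => p hp.
  (* Either [p] contains [J] and inherits the colon condition from it, or [p] and [J] are
     comaximal. *)
  have [Jp|/existsNP[z /not_implyP[Jz npz]]] := pselect (forall z, J z -> p z).
    right=> z hz; apply: tcolon => f x; apply/hz/Jp.
    by move=> I _; apply.
  left; have [y py] := hp.2 z npz; exists (1 - z * y) => //.
  by rewrite opprB addrCA subrr addr0; apply: (ideal_mulr y hJ).
have [|x hx] := @exists_generic ps.
  apply: every_impl hps => p hp; split=> //; apply: contrapT => no.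
  have [[pI p1 _] _] := hp; apply: p1; apply: J1 => // f x.
  by apply: contrapT => n; apply: no; exists f, x.
(* The values at the generic [x] form an ideal comaximal with each ideal in [ps], hence with [D],
   which contains their product. *)
have : exists a b, [/\ exists f, a = f x, D b & 1 = a + b].
  pose I (a : A) := exists f, a = f x.
  have hI : is_ideal I.
    split; first by exists 0.
    move=> c _ _ [f ->] [g ->].
    by exists ((c : A) *: (f : hom_mod M A^o) + (g : hom_mod M A^o)).
  apply: (@kills_mem _ D _ ps 1 (ideal_add hI hD) _ _ kps).
    by move=> z Dz; exists 0, z; split; rewrite ?add0r //; exists 0.
  elim: ps hps hx {kps} => //= p ps IHps /andP[/asboolP hp hps].
  move=> /andP[/asboolP[f npf] hx]; apply/andP; split; last exact: IHps.
  apply/asboolP; left; have [y py] := hp.2 _ npf; exists (1 - f x * y) => //.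
  rewrite opprB addrCA subrr addr0; exists (f x * y), 0; split.
  - by exists (y *: f); rewrite mulrC.
  - exact: hD.1.
  - by rewrite addr0.
(* Since [t] is in the Jacobson radical, [f x = 1 - t * b] is a unit; rescale [f] by its inverse. *)
move=> [_ [_ [[f ->] [b ->] e]]]; have [v hv] := tjac b.
by exists (v *: f), x; rewrite -hv e addrK mulrC.
Qed.

End Semilocal.

(** * Modules over a birational finite extension *)

Lemma bidualityP (A : comNzRingType) (M : lmodType A) :
  bijective (@biduality A M) <->
  (forall x : M, (forall f : hom_mod M A^o, f x = 0) -> x = 0) /\
  (forall F : {linear hom_mod M A^o -> A^o}, exists x, forall f, F f = f x).
Proof.
split=> [[G GK KG]|[inj surj]].
  have b0 : G 0 = 0.
    by rewrite -[RHS]GK; congr (G _); apply: hom_ext => f; rewrite /= [RHS]linear0.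
  split=> [x x0|F].
    by rewrite -b0 -[LHS]GK; congr (G _); apply: hom_ext => f; exact: x0.
  by exists (G F) => f; rewrite -[in LHS](KG F).
have bij (F : hom_mod (hom_mod M A^o) A^o) : exists x, biduality x = F.
  by have [x hx] := surj F; exists x; apply: hom_ext => f /=; rewrite hx.
have [G hG] := choice bij; exists G => // x.
apply/eqP; rewrite -subr_eq0; apply/eqP/inj => f; rewrite linearB /=.
have e : f (G (biduality x)) = f x.
  exact: (congr1 (fun F : hom_mod (hom_mod M A^o) A^o => F f) (hG (biduality x))).
by rewrite e subrr.
Qed.

Lemma linear_bij (A : comNzRingType) (M N : lmodType A) (f : {linear M -> N}) :
  (forall x, f x = 0 -> x = 0) -> (forall y, exists x, f x = y) -> bijective f.
Proof.
move=> inj surj; have [g gK] := choice surj; exists g => // x.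
by apply/eqP; rewrite -subr_eq0; apply/eqP/inj; rewrite linearB /= gK subrr.
Qed.

Lemma lreg0 (A : comNzRingType) (d x : A) : GRing.lreg d -> d * x = 0 -> x = 0.
Proof. by move=> rd dx; apply: rd; rewrite dx mulr0. Qed.

Section MkLinear.
Variables (A : comNzRingType) (M N : lmodType A) (f : M -> N).
Hypothesis lf : linear f.
HB.instance Definition _ := GRing.isLinear.Build A M N _ f lf.
Definition linear_of : {linear M -> N} := f.
End MkLinear.

(* rho inverts phi on its image; its values elsewhere are irrelevant. *)
Section Birational.
Variables (R B : comNzRingType) (phi : {rmorphism R -> B}) (rho : B -> R) (d : R).
Hypotheses (rhoK : cancel phi rho) (finB : fin_gen (restr phi B^o)).
Hypotheses (reg_phi : forall a, GRing.lreg a -> GRing.lreg (phi a)).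
Hypotheses (rd : GRing.lreg d) (dB : forall b, exists a, phi d * b = phi a).

Local Notation BR := (restr phi B^o).

(* Membership in the conductor, as an ideal of B. *)
Definition cond (b : B) := forall b', exists a, b * b' = phi a.

Lemma rhoP x a : x = phi a -> phi (rho x) = x.
Proof. by move=> ->; rewrite rhoK. Qed.

Lemma cond_rho b b' : cond b -> phi (rho (b * b')) = b * b'.
Proof. by move=> /(_ b')[a e]; apply: rhoP e. Qed.

Lemma cond_rho1 b : cond b -> phi (rho b) = b.
Proof. by move=> cb; have := cond_rho 1 cb; rewrite mulr1. Qed.

Lemma cond0 : cond 0.
Proof. by move=> b; exists 0; rewrite mul0r rmorph0. Qed.

Lemma condD a x y : cond x -> cond y -> cond (a * x + y).
Proof.
move=> cx cy b; have [e ex] := cx (a * b); have [f fy] := cy b.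
by exists (e + f); rewrite rmorphD /= -ex -fy; ring.
Qed.

Lemma cond_is_ideal : is_ideal cond.
Proof. by split; [exact: cond0|exact: condD]. Qed.

Lemma cond_d : cond (phi d).
Proof. exact: dB. Qed.

Lemma fin_gen_restr (M : lmodType B) : fin_gen M <-> fin_gen (restr phi M).
Proof.
split=> [[n [g gen]]|[n [g gen]]]; last first.
  by exists n, g => x; have [c ->] := gen x; exists (fun i => phi (c i)).
have [k [h genB]] := finB.
pose gh (i : 'I_#|{: 'I_n * 'I_k}|) : restr phi M :=
  (h (enum_val i).2 : B) *: g (enum_val i).1.
exists #|{: 'I_n * 'I_k}|, gh => x; have [c ->] := gen x.
have [e he] := choice (fun i => genB (c i)).
exists (fun i => e (enum_val i).1 (enum_val i).2).
rewrite -(big_enum_val (A := {: 'I_n * 'I_k}) (fun ij : 'I_n * 'I_k =>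
  e ij.1 ij.2 *: ((h ij.2 : B) *: g ij.1 : restr phi M))).
rewrite -(pair_bigA _ (fun i j => e i j *: ((h j : B) *: g i : restr phi M))) /=.
apply: eq_bigr => i _; rewrite (he i).
rewrite [LHS]scaler_suml; apply: eq_bigr => j _.
exact: (esym (scalerA (phi (e i j)) (h j : B) (g i))).
Qed.

(** Clear denominators: [phi d * b] comes from [R], over which [g] is linear, and [phi d] is
    regular. *)
Lemma hom_semilinear (M : lmodType B) (g : {linear restr phi M -> R^o}) b (x : M) :
  phi (g (b *: x)) = b * phi (g x).
Proof.
have [a ha] := dB b; apply: (reg_phi rd).
have e : d *: (b *: x : restr phi M) = a *: (x : restr phi M).
  by rewrite [LHS]scalerA ha.
rewrite mulrA ha -!rmorphM.
have := congr1 g e; rewrite !linearZ => e'.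
exact: (congr1 phi e').
Qed.

Lemma hom_semilinear1 (g : {linear BR -> R^o}) b :
  phi (g b) = b * phi (g (1 : B)).
Proof. by rewrite -(@hom_semilinear B^o) [_ *: _]mulr1. Qed.

Lemma cond_hom (M : lmodType B) (g : {linear restr phi M -> R^o}) x :
  cond (phi (g x)).
Proof. by move=> b; exists (g (b *: (x : M))); rewrite hom_semilinear mulrC. Qed.

Lemma linear_rho (V : lmodType R) (f : V -> B) :
  (forall x, exists a, f x = phi a) ->
  (forall a x y, f (a *: x + y) = phi a * f x + f y) ->
  exists g : {linear V -> R^o}, forall x, phi (g x) = f x.
Proof.
move=> fim flin.
have lg : linear (fun x => rho (f x) : R^o).
  move=> a x y; rewrite flin; have [x' ->] := fim x; have [y' ->] := fim y.
  by rewrite -rmorphM -rmorphD !rhoK.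
exists (linear_of lg) => x.
by have [a e] := fim x; apply: rhoP e.
Qed.

Lemma cond_mul_hom x : cond x ->
  exists g : {linear BR -> R^o}, forall b : B, phi (g b) = x * b.
Proof.
by move=> cx; apply: linear_rho => // a b c; rewrite mulrDr mulrCA.
Qed.

Variable c : submodClosed R^o.
Hypothesis cE : forall a, a \in c <-> cond (phi a).

Lemma cond_mem x : cond x -> exists y : submod c, phi (submod_val y) = x.
Proof.
move=> cx; have e := cond_rho1 cx.
have xc : rho x \in c by apply/cE; rewrite e.
by exists (Submod xc).
Qed.

(** Every implication between the three conditions passes through this one. *)
Definition principal_conductor := exists u : B,
  GRing.lreg u /\ forall x, cond x <-> exists s, x = u * s.

Lemma lreg_factor (u v w : B) : GRing.lreg w -> w = u * v -> GRing.lreg u.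
Proof.
move=> rw e; apply: mulrI0_lreg => x ux; apply: (lreg0 rw).
by rewrite e mulrAC ux mul0r.
Qed.

Lemma principal_of_generator u : (forall x, cond x <-> exists s, x = u * s) ->
  principal_conductor.
Proof.
move=> uE; exists u; split=> //.
have [s e] := (uE _).1 cond_d; exact: (lreg_factor (reg_phi rd) e).
Qed.

(** This is [(C : C) = B]. Evaluation at 1 identifies [Hom_R(B, R)] with [C], so [f] yields a
    functional on the dual of [B]; by reflexivity it is evaluation at some [s]. *)
Lemma reflexive_end (f : {linear submod c -> submod c}) : Ref BR ->
  exists s, forall x, phi (submod_val (f x)) = s * phi (submod_val x).
Proof.
move=> [_ /bidualityP[_ surj]].
have g1c (g : hom_mod BR R^o) : g (1 : B) \in c by apply/cE/cond_hom.
have lin : linear (fun g : hom_mod BR R^o => submod_val (f (Submod (g1c g))) : R^o).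
  move=> a g h; rewrite -[RHS]/(submod_val (a *: f _ + f _)) -linearP.
  by congr (submod_val (f _)); apply/val_inj.
have [s hs] := surj (linear_of lin); exists s => x.
have [g hg] := cond_mul_hom ((cE _).1 (submod_valP x)).
rewrite mulrC -hg.
have := congr1 phi (hs g); rewrite /= => <-.
congr (phi (submod_val (f _))); apply/val_inj => /=.
by apply: (can_inj rhoK); rewrite hg mulr1.
Qed.

(** The generator [y] corresponds to the identity. For [z] in [C], [f z] is multiplication by some
    [s = a / d], so [a *: y] and [d *: z] have the same image under [f], whence [z = s y]. *)
Lemma stable_principal : Ref BR ->
  isomorphic (submod c) (hom_mod (submod c) (submod c)) -> principal_conductor.
Proof.
move=> refB [f [G GK KG]].
pose y : submod c := G (idfun : {linear submod c -> submod c}).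
have fy : f y = (idfun : {linear submod c -> submod c}) by apply: KG.
have cu : cond (phi (submod_val y)) by apply/cE/submod_valP.
apply: (principal_of_generator (u := phi (submod_val y))) => x; split; last first.
  by move=> [s ->]; apply: (ideal_mulr s cond_is_ideal cu).
move=> /cond_mem[z <-]; have [s hs] := reflexive_end (f z) refB.
have [a ha] := dB s.
have e : a *: y = d *: z.
  apply: (can_inj GK); rewrite !linearZ fy; apply: hom_ext => w; apply/val_inj.
  apply: (can_inj rhoK); rewrite /= !rmorphM /= hs mulrA ha //.
exists s; apply: (reg_phi rd).
have := congr1 (fun w : submod c => phi (submod_val w)) e.
by rewrite /= !rmorphM /= -ha => <-; ring.
Qed.

(** Send [s] to multiplication by [u s]; every functional is multiplication by its value at 1, which
    lies in [C]. *)
Lemma principal_iso : principal_conductor -> isomorphic BR (hom_mod BR R^o).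
Proof.
move=> [u [ru uE]].
have cus s : cond (u * s) by apply/uE; exists s.
have [h hE] := choice (fun s => cond_mul_hom (cus s)).
have lin : linear (h : BR -> hom_mod BR R^o).
  move=> a x y; apply: hom_ext => b; apply: (can_inj rhoK).
  rewrite [RHS]rmorphD [X in _ = X + _]rmorphM /= !hE.
  by rewrite -[a *: x]/(phi a * (x : B)); ring.
exists (linear_of lin); apply: linear_bij => [s hs|g].
  have := hE s 1; rewrite -[h s]/(linear_of lin s) hs /= rmorph0 mulr1.
  by move=> /esym/(lreg0 ru).
have [s e] := (uE _).1 (cond_hom g (1 : B)).
exists s; apply: hom_ext => b; apply: (can_inj rhoK).
by rewrite /= hE hom_semilinear1 e mulrC.
Qed.

(** Semilinearity in both arguments gives [F s b = b s u] with [u = F 1 1], and [C] consists of the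
    values at 1 of functionals. *)
Lemma iso_principal : isomorphic BR (hom_mod BR R^o) -> principal_conductor.
Proof.
move=> [F [G GK KG]].
have lin : linear (fun s : BR => (F s : hom_mod BR R^o) (1 : B) : R^o).
  by move=> a x y; rewrite linearP.
have FE s b : phi (F s b) = b * (s * phi (F (1 : B) (1 : B))).
  by rewrite hom_semilinear1 -(hom_semilinear1 (linear_of lin)).
apply: (principal_of_generator (u := phi (F (1 : B) (1 : B)))) => x; split.
  move=> /cond_mul_hom[g hg]; exists (G g).
  by have := hg 1; rewrite mulr1 => <-; rewrite -[in LHS](KG g) [LHS]FE mul1r mulrC.
move=> [s ->]; have := cond_hom (F s) (1 : B).
by rewrite (FE s) mul1r mulrC.
Qed.

(** Let [x] act on [C] as multiplication by [x / u]. An endomorphism [g] satisfies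
    [u g(z) = g(u z) = z g(u)], so it comes from [g(u)]. *)
Lemma principal_stable : principal_conductor -> stable_ideal c.
Proof.
move=> [u [ru uE]]; split.
  by exists d; [apply/cE; exact: cond_d|rewrite inE; apply/asboolP].
have /cond_mem[y yE] : cond u by apply/uE; exists 1; rewrite mulr1.
have mulh (x : submod c) : exists h : {linear submod c -> submod c},
    forall z, u * phi (submod_val (h z)) = phi (submod_val x) * phi (submod_val z).
  have [s xE] := (uE _).1 ((cE _).1 (submod_valP x)).
  have cz (z : submod c) : cond (s * phi (submod_val z)).
    by apply: (ideal_mull s cond_is_ideal); apply/cE/submod_valP.
  have [h hE] := choice (fun z => cond_mem (cz z)).
  have lin : linear h.
    move=> a z w; apply/val_inj/(can_inj rhoK).
    by rewrite /= !(rmorphD, rmorphM) /= !hE /= !(rmorphD, rmorphM) /=; ring.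
  by exists (linear_of lin) => z; rewrite /= hE mulrA -xE.
have [h hE] := choice mulh.
have lin : linear (h : _ -> hom_mod (submod c) (submod c)).
  move=> a x z; apply: hom_ext => w; apply/val_inj/(can_inj rhoK)/ru.
  rewrite /= !(rmorphD, rmorphM) /= mulrDr mulrCA !hE /=.
  by rewrite !(rmorphD, rmorphM) /=; ring.
exists (linear_of lin); apply: linear_bij => [x hx|g].
  apply/val_inj/(can_inj rhoK)/ru.
  have := hE x y; rewrite -[h x]/(linear_of lin x) hx /= yE rmorph0 mulr0.
  by rewrite mulrC.
exists (g y); apply: hom_ext => z; apply/val_inj/(can_inj rhoK)/ru.
rewrite /= hE -yE -!rmorphM; congr (phi _).
have e : (submod_val y : R) *: z = (submod_val z : R) *: y.
  by apply/val_inj; rewrite /= [LHS]mulrC.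
have gZ a w : g (a *: w) = a *: g w by rewrite linearZ.
have := congr1 (fun w => submod_val (g w)) e.
by rewrite !gZ => e'; rewrite [LHS]mulrC; exact: (esym e').
Qed.

Section Transfer.
Variable u : B.
Hypotheses (ru : GRing.lreg u) (uE : forall x, cond x <-> exists s, x = u * s).

Lemma hom_to_base (M : lmodType B) (f : {linear M -> B^o}) :
  exists g : {linear restr phi M -> R^o}, forall x, phi (g x) = u * f x.
Proof.
apply: (@linear_rho (restr phi M) (fun x => u * f x)) => [x|a x y].
  have cu : cond (u * f x) by apply/uE; exists (f x).
  by have [a] := cu 1; rewrite mulr1 => e; exists a.
rewrite [f _](linearP f (phi a)) mulrDr; congr (_ + _).
by rewrite mulrCA.
Qed.

Lemma hom_from_base (M : lmodType B) (g : {linear restr phi M -> R^o}) :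
  exists f : {linear M -> B^o}, forall x, u * f x = phi (g x).
Proof.
have ex x : exists s, u * s = phi (g x).
  by have [s e] := (uE _).1 (cond_hom g x); exists s.
have [f fE] := choice ex.
have lin : linear (f : M -> B^o).
  move=> a x y; apply: ru; rewrite fE mulrDr mulrCA !fE -hom_semilinear -rmorphD.
  by congr (phi _); rewrite -linearD.
by exists (linear_of lin) => x; rewrite /= fE.
Qed.

(** Multiplication by [u] identifies [Hom_B(M, B)] with [Hom_R(M, R)]. Used for [M] and again for
    [Hom_B(M, B)], it matches the biduals compatibly with evaluation. *)
Lemma Ref_restr (M : lmodType B) : Ref M <-> Ref (restr phi M).
Proof.
have [al alE] := choice (@hom_to_base M); have [be beE] := choice (@hom_from_base M).
have albe g : al (be g) = g :> hom_mod (restr phi M) R^o.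
  by apply: hom_ext => x; apply: (can_inj rhoK); rewrite alE beE.
have beal f : be (al f) = f :> hom_mod M B^o.
  by apply: hom_ext => x; apply: ru; rewrite beE alE.
rewrite /Ref !bidualityP fin_gen_restr; split=> -[fg [inj surj]]; split=> //; split.
- move=> x x0; apply: inj => f; apply: ru; rewrite -alE.
  by rewrite (x0 (al f)) rmorph0 mulr0.
- move=> F.
  have lin : linear ((fun f => F (al f)) : restr phi (hom_mod M B^o) -> R^o).
    move=> a f g; rewrite -linearP; congr (F _); apply: hom_ext => x.
    apply: (can_inj rhoK); rewrite /= rmorphD rmorphM /= !alE /= mulrDr.
    by congr (_ + _); rewrite mulrCA.
  have [Psi PsiE] := hom_from_base (linear_of lin).
  have [x xE] := surj Psi; exists x => g; apply: (can_inj rhoK).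
  have := PsiE (be g); rewrite /= albe => <-.
  by rewrite xE beE.
- move=> x x0; apply: inj => g; apply: (can_inj rhoK); rewrite -beE.
  by rewrite (x0 (be g)) mulr0 rmorph0.
- move=> Psi; have [G GE] := @hom_to_base (hom_mod M B^o) Psi.
  have lin : linear ((fun g => G (be g)) : hom_mod (restr phi M) R^o -> R^o).
    move=> a f g; rewrite -linearP; congr (G _); apply: hom_ext => x.
    apply: ru; rewrite [RHS]mulrDr [X in _ = X + _]mulrCA !beE.
    by rewrite /= rmorphD rmorphM.
  have [x xE] := surj (linear_of lin); exists x => f; apply: ru.
  by rewrite -GE -[X in G X]beal -alE -xE.
Qed.

End Transfer.

End Birational.

(** * The conductor as a module over the extension *)

Lemma Ref_regular (A : comNzRingType) : Ref A^o.
Proof.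
split; first by exists 1%N, (fun=> 1) => x; exists (fun=> x); rewrite big_ord1 [RHS]mulr1.
pose id1 : hom_mod A^o A^o := (idfun : {linear A^o -> A^o}).
apply/bidualityP; split=> [x x0|F]; first exact: (x0 id1).
have mulE (f : {linear A^o -> A^o}) (x : A) : f x = x * f 1.
  by rewrite -[RHS]/((x : A) *: f 1) -linearZ; congr (f _); rewrite [RHS]mulr1.
exists (F id1) => f; have fE : f = (f 1 : A) *: id1.
  by apply: hom_ext => x; rewrite mulE mulrC.
rewrite [in LHS]fE linearZ [RHS]mulE; exact: mulrC.
Qed.

Section Conductor.
Variables (R B : comNzRingType) (phi : {rmorphism R -> B}) (rho : B -> R) (d : R).
Hypotheses (rhoK : cancel phi rho) (finB : fin_gen (restr phi B^o)).
Hypotheses (reg_phi : forall a, GRing.lreg a -> GRing.lreg (phi a)).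
Hypotheses (rd : GRing.lreg d) (dB : forall b, exists a, phi d * b = phi a).
Hypothesis noethR : noetherian R.

Local Notation BR := (restr phi B^o).
Local Notation cond := (cond phi).

(** For an ideal [I] of [B], [d I] is an ideal of [R]; its generators divided by [d] generate
    [I]. *)
Lemma noetherian_ext : noetherian B.
Proof.
move=> I; have [del delE] := choice dB.
pose J a := exists2 x : B, x \in I & phi a = phi d * x.
have hJ : is_ideal J.
  split; first by exists 0; [exact: rpred0|rewrite mulr0 rmorph0].
  move=> a b e [x xI bE] [y yI eE]; exists (phi a * x + y).
    exact: (rpredD (rpredZ (phi a) xI) yI).
  by rewrite rmorphD rmorphM /= bE eE; ring.
have [n [g [Jg gen]]] := noetherian_fg noethR hJ.
have ex i : exists x : submod I, phi (g i) = phi d * submod_val x.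
  by have [x xI e] := Jg i; exists (Submod xI).
have [h hE] := choice ex; exists n, h => x.
have [|c e] := gen (del (submod_val x)).
  by exists (submod_val x); [exact: submod_valP|rewrite -delE].
exists (fun i => phi (c i)); apply/val_inj/(reg_phi rd).
rewrite [LHS]delE e rmorph_sum /=.
rewrite (big_morph (@submod_val _ _ I) (fun _ _ => erefl) erefl) mulr_sumr.
apply: eq_bigr => i _; rewrite rmorphM hE; exact: mulrCA.
Qed.

Definition cond_mod : submodClosed B^o :=
  @submod_of B B^o cond (cond0 phi) (condD (phi := phi)).

Lemma cond_modP (x : submod cond_mod) : cond (submod_val x).
Proof. exact/asboolP/(submod_valP x). Qed.

Lemma cond_mod_mem x : cond x -> exists y : submod cond_mod, submod_val y = x.
Proof. by move=> cx; have xc : x \in cond_mod by [apply/asboolP]; exists (Submod xc). Qed.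

Lemma cond_mod_val : exists f : {linear submod cond_mod -> B^o},
  forall x, f x = submod_val x.
Proof. by have lin : linear (@submod_val _ _ cond_mod); [|exists (linear_of lin)]. Qed.

(* R :_Q C = B, since B is reflexive over R *)
Lemma hom_cond_mod (g : {linear restr phi (submod cond_mod) -> R^o}) : Ref BR ->
  exists s, forall x, phi (g x) = s * submod_val x.
Proof.
move=> [_ /bidualityP[_ surj]].
have c1 (k : hom_mod BR R^o) : phi (k (1 : B)) \in cond_mod.
  by apply/asboolP; apply: (cond_hom reg_phi rd dB).
have lin : linear (fun k : hom_mod BR R^o =>
    g (Submod (c1 k) : restr phi (submod cond_mod)) : R^o).
  move=> a k l; rewrite -linearP; congr (g _); apply/val_inj => /=.
  by rewrite rmorphD rmorphM.
have [s sE] := surj (linear_of lin); exists s => x.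
have [k kE] := cond_mul_hom rhoK (cond_modP x).
rewrite mulrC -kE -sE /=; congr (phi (g _)); apply/val_inj => /=.
by rewrite kE mulr1.
Qed.

(** The dual of [C] is [B] by [hom_cond_mod], and the dual of [B] is [C]: [F] is evaluation at
    [F (g 1)], where [g 1] is the inclusion of [C]. *)
Lemma Ref_cond_mod : Ref BR -> Ref (restr phi (submod cond_mod)).
Proof.
move=> refB; split; first by apply/(fin_gen_restr finB)/noetherian_ext.
have ms (s : B) : exists g : {linear restr phi (submod cond_mod) -> R^o},
    forall x, phi (g x) = s * submod_val x.
  apply: (linear_rho rhoK) => [x|a x y].
    by have [a] := cond_modP x s; rewrite mulrC => e; exists a.
  by rewrite /= mulrDr; congr (_ + _); exact: mulrCA.
have [g gE] := choice ms.
apply/bidualityP; split=> [x x0|F].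
  by apply/val_inj; rewrite -[LHS]mul1r -gE x0 rmorph0.
have lin : linear ((fun s => F (g s)) : BR -> R^o).
  move=> a s s'; rewrite -linearP; congr (F _); apply: hom_ext => x.
  apply: (can_inj rhoK); rewrite /= rmorphD rmorphM /= !gE.
  by rewrite -[a *: s]/(phi a * (s : B)); ring.
have FE s := hom_semilinear1 reg_phi rd dB (linear_of lin) s.
have [x xE] : exists x : submod cond_mod, submod_val x = phi (F (g 1)).
  by apply: cond_mod_mem; apply: (cond_hom reg_phi rd dB (linear_of lin)).
exists x => h; have [s hs] := hom_cond_mod h refB.
have -> : h = g s :> hom_mod _ _.
  by apply: hom_ext => y; apply: (can_inj rhoK); rewrite hs gE.
by apply: (can_inj rhoK); rewrite gE xE -FE.
Qed.

Variable t : R.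
Hypotheses (rt : GRing.lreg t) (tcond : cond (phi t)).
Hypotheses (tjac : forall a, exists b, (1 - t * a) * b = 1)
  (tmax : forall p, is_prime p -> p (phi t) -> is_max_prime p).

(** Once [f x = 1] for some [x] in [C], every [w] in [C] equals [f(w) x], because [w x = x w]. *)
Lemma reflexive_cond_principal : Ref BR -> Ref (submod cond_mod) ->
  principal_conductor phi.
Proof.
move=> refB [_ /bidualityP[_ surj]].
have [inc incE] := cond_mod_val.
have rphit := reg_phi rt.
have [|||||f [x fx]] := @exists_unimodular B (submod cond_mod) (phi t).
- exact: noetherian_ext.
- exact: fin_ext_one_sub_unit.
- exact: tmax.
- by have [y yE] := cond_mod_mem tcond; exists inc, y; rewrite incE.
(* By reflexivity of [C] over [B], [f |-> z f(x) / t] is evaluation at some [y] in [C]. So [z / t]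
   multiplies [C] into [C], hence into [R], and lies in [R : C = B]. *)
- move=> z hz.
  have zx (x : submod cond_mod) : exists y : submod cond_mod,
      z * submod_val x = phi t * submod_val y.
    have [h hE] := choice (fun f => hz f x).
    have lin : linear (h : hom_mod (submod cond_mod) B^o -> B^o).
      move=> a f g; apply: rphit; rewrite -[LHS]hE -[a *: (h f : B^o)]/(a * h f).
      rewrite [RHS]mulrDr [X in _ = X + _]mulrCA -!hE [LHS]mulrDr.
      by congr (_ + _); exact: mulrCA.
    have [y yE] := surj (linear_of lin); exists y.
    by have := hE inc; rewrite -[h inc]/(linear_of lin inc) yE !incE.
  have [y yE] := choice zx.
  have [|a x x'|g gE] := @linear_rho _ _ _ _ rhoK
    (restr phi (submod cond_mod)) (fun x => submod_val (y x)).
  + by move=> x; have [a] := cond_modP (y x) 1; rewrite mulr1 => e; exists a.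
  + apply: rphit; rewrite -[LHS]yE [RHS]mulrDr [X in _ = X + _]mulrCA -!yE.
    rewrite [LHS]mulrDr; congr (_ + _); exact: mulrCA.
  have [s sE] := hom_cond_mod g refB; exists s.
  have [x xE] := cond_mod_mem (cond_d dB); apply: (reg_phi rd).
  by rewrite mulrC -xE yE -gE sE; ring.
apply: (principal_of_generator reg_phi rd dB (u := submod_val x)) => z; split.
  move=> /cond_mod_mem[w <-]; exists (f w).
  have e : (submod_val w : B) *: x = (submod_val x : B) *: w.
    by apply/val_inj; exact: mulrC.
  have fZ b v : f (b *: v) = b * f v by rewrite linearZ.
  by rewrite -fZ -e fZ fx mulr1.
move=> [s ->]; apply: (ideal_mulr s (cond_is_ideal phi)); exact: cond_modP.
Qed.

End Conductor.

(** * Subrings of the total ring of fractions *)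

Section TotalFractions.
Variable R : comNzRingType.
Local Notation Q := (total_fractions R).

Lemma nonzerodivisors_lreg (s : denom (nonzerodivisors R)) : GRing.lreg (denom_val s).
Proof. by have := denomP s; rewrite inE => /asboolP. Qed.

Lemma to_total_inj : injective (to_loc (nonzerodivisors R)).
Proof.
move=> a b /ringfrac_eqP[u] /=; rewrite mulr1.
exact: nonzerodivisors_lreg.
Qed.

Lemma to_total_lreg a : GRing.lreg a -> GRing.lreg (to_loc (nonzerodivisors R) a).
Proof.
move=> ra; apply: mulrI0_lreg => x; have [b [s ->]] := ringfracP x.
rewrite ringfrac_mul => /ringfrac_eqP[u] /=; rewrite mulr0 mulr1.
move=> /(lreg0 (@nonzerodivisors_lreg u))/(lreg0 ra) ->.
by apply/ringfrac_eqP; exists (denom1 _); rewrite !mulr0.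
Qed.

Lemma total_denominator (x : Q) : exists2 s, GRing.lreg s &
  exists a, to_loc _ s * x = to_loc _ a.
Proof.
have [a [s ->]] := ringfracP x; exists (denom_val s).
  exact: nonzerodivisors_lreg.
by exists a; rewrite (ringfracE a s) mulrC.
Qed.

Variables (S : subringClosed Q) (RS : forall a : R, to_loc (nonzerodivisors R) a \in S).
Local Notation phi := (corestr RS).

Lemma corestr_inj : injective phi.
Proof. by move=> a b /(congr1 val) /= /to_total_inj. Qed.

Lemma corestr_lreg a : GRing.lreg a -> GRing.lreg (phi a).
Proof.
by move=> ra x y /(congr1 val) /= /(to_total_lreg ra) e; apply/val_inj.
Qed.

Lemma corestr_section : exists rho : subring S -> R, cancel phi rho.
Proof.
have ex b : exists a, forall a', b = phi a' -> a = a'.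
  have [[a e]|no] := pselect (exists a, b = phi a).
    by exists a => a'; rewrite e => /corestr_inj.
  by exists 0 => a' e; case: no; exists a'.
by have [rho h] := choice ex; exists rho => a; apply: h.
Qed.

Lemma corestr_denominator : fin_gen (restr phi (subring S)^o) ->
  exists2 d, GRing.lreg d & forall b : subring S, exists a, phi d * b = phi a.
Proof.
move=> [n [g gen]].
have ex i : exists s, GRing.lreg s /\ exists a, phi s * (g i : subring S) = phi a.
  have [s rs [a e]] := total_denominator (val (g i : subring S)).
  by exists s; split=> //; exists a; apply/val_inj.
have [s hs] := choice ex; have [a ha] := choice (fun i => (hs i).2).
exists (\prod_i s i).
  by elim/big_ind: _ => [|x y|i _]; [exact: lreg1|exact: lregM|exact: (hs i).1].
move=> b; have [c ->] := gen b.
exists (\sum_i c i * ((\prod_(j | j != i) s j) * a i)).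
rewrite rmorph_sum mulr_sumr; apply: eq_bigr => i _.
rewrite -[c i *: g i]/(phi (c i) * (g i : subring S)) (bigD1 i) //= !rmorphM /= -ha; ring.
Qed.

Lemma mem_conductor a : a \in conductor S <-> cond phi (phi a).
Proof.
split=> [/asboolP h b|h]; last first.
  apply/asboolP => x xS; have [a' /(congr1 val) e] := h (Subring xS).
  by exists a'.
by have [a' e] := h (val b) (valP b); exists a'; apply/val_inj.
Qed.

End TotalFractions.

(** * The cycle of implications *)

Lemma birational_equivalences (R B : comNzRingType) (phi : {rmorphism R -> B})
    (rho : B -> R) (d : R) (c : submodClosed R^o)
    (noethR : noetherian R) (localR : local_ring R) (cmR : cohen_macaulay R)
    (dimR : krull_dim_eq R 1)
    (rhoK : cancel phi rho) (finB : fin_gen (restr phi B^o))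
    (reg_phi : forall a, GRing.lreg a -> GRing.lreg (phi a))
    (rd : GRing.lreg d) (dB : forall b, exists a, phi d * b = phi a)
    (cE : forall a, a \in c <-> cond phi (phi a)) :
  [<-> Ref (restr phi B^o) /\ stable_ideal c;
       isomorphic (restr phi B^o) (hom_mod (restr phi B^o) R^o);
       forall M : lmodType B, Ref M <-> CM M /\ Ref (restr phi M)].
Proof.
have [m hm] := local_ring_ideal noethR localR.
have dim1 : dim_ge R 1 by apply/dimR.
have dim2 : ~ dim_ge R 2 by move=> /dimR.
have [t0 mt0 rt0] := exists_nonzerodivisor noethR hm cmR dim1.
(* The factor [t0] puts [t] in [m], the factor [d] puts [phi t] in the conductor; both are
   regular. *)
pose t := t0 * d.
have [[mI m1 mM] mu] := hm.
have mt : m t by apply: ideal_mulr.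
have rt : GRing.lreg t by apply: lregM.
have ct : cond phi (phi t).
  by rewrite rmorphM; apply: (ideal_mull _ (cond_is_ideal _)); exact: dB.
have CMreg := CM_of_regular finB hm dim2 mt.
have tjac a : exists b, (1 - t * a) * b = 1.
  apply: mu => h; apply: m1; apply: (idealDl mI _ h).
  by rewrite -mulrN; apply: ideal_mulr.
(* Such a [p] lies over [m], so an element outside [p] has a multiple congruent modulo [p] to the
   image of a unit of [R]. *)
have tmax p : is_prime p -> p (phi t) -> is_max_prime p.
  move=> hp pt; split=> // x nx; have [pI _ _] := hp.
  have [a [y [na pa]]] := fin_ext_meets_base finB hp nx.
  have qm := prime_nzd_maximal noethR dim2 hm (prime_preim phi hp) pt rt.
  have [b ab] : exists b, a * b = 1 by apply: mu => /qm.
  exists (y * phi b); rewrite -(rmorph1 phi) -ab rmorphM mulrA -mulrBl.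
  exact: ideal_mulr.
tfae.
- move=> [refB [_ isoB]]; apply: (principal_iso rhoK reg_phi rd dB).
  exact: (stable_principal rhoK reg_phi rd dB cE refB isoB).
- move=> /(iso_principal rhoK reg_phi rd dB)[u [ru uE]] M.
  have refM := Ref_restr rhoK finB reg_phi rd dB ru uE M.
  split=> [rM|[_ /refM]//]; split; last exact/refM.
  (* Functionals into [B] separate the points of [M], and [phi t] is regular on [B]; hence it is
     regular on [M]. *)
  have [fM /bidualityP[inj _]] := rM; apply: CMreg => // x tx.
  apply: inj => f; apply: (lreg0 (reg_phi _ rt)).
  by rewrite -[LHS]/((phi t : B) *: f x) -linearZ tx linear0.
(* Condition (3) is used twice: at [B] it gives reflexivity over [R], and at [C], which is
   torsion-free and reflexive over [R], it gives reflexivity over [B]. *)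
- move=> h; have [_ refB] := (h _).1 (Ref_regular B).
  have refC : Ref (submod (cond_mod phi)).
    apply/h; split; last exact: (Ref_cond_mod rhoK finB reg_phi rd dB noethR refB).
    apply: CMreg; first exact: (noetherian_ext reg_phi rd dB noethR).
    move=> x /(congr1 (@submod_val _ _ _)) tx; apply/val_inj.
    exact: (lreg0 (reg_phi _ rt) tx).
  split=> //; apply: (principal_stable rhoK rd dB cE).
  exact: (reflexive_cond_principal rhoK finB reg_phi rd dB noethR rt ct tjac
            tmax refB refC).
Qed.

Theorem theorem1p1 (R : comNzRingType)
    (noethR : noetherian R) (localR : local_ring R) (cmR : cohen_macaulay R)
    (dimR : krull_dim_eq R 1) (ggR : generically_gorenstein R)
    (S : subringClosed (total_fractions R))
    (RS : forall a : R, to_loc (nonzerodivisors R) a \in S)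
    (finS : fin_gen (restr (corestr RS) (subring S)^o)) :
  let S_R : lmodType R := restr (corestr RS) (subring S)^o in
  [<-> Ref S_R /\ stable_ideal (conductor S);
       isomorphic S_R (hom_mod S_R R^o);
       forall M : lmodType (subring S),
         Ref M <-> CM M /\ Ref (restr (corestr RS) M)].
Proof.
move=> S_R.
have [rho rhoK] := corestr_section RS.
have [d rd dB] := corestr_denominator finS.
exact: (birational_equivalences noethR localR cmR dimR rhoK finS
          (@corestr_lreg _ _ RS) rd dB (mem_conductor RS)).
Qed.
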